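(* Up to Euclidean equivalence, the circular translation $$C := \bigl(t-((x e_{1}+y e_{2})(e_-+e_+)-e_{12})\bigr)(t-e_{12})$$ (with real parameters $x,y$) is the only non-trivial quadratic Euclidean motion that has irregular factorizations.
   Context: $\mathrm{CGA}$ (conformal geometric algebra) is the real Clifford algebra of signature $(4,1)$ with orthonormal generators $e_1,e_2,e_3,e_+,e_-$ satisfying $e_1^2=e_2^2=e_3^2=e_+^2=1$, $e_-^2=-1$ and $e_ie_j=-e_je_i$ for $i\neq j$. Products of generators are written $e_{12}=e_1e_2$, $e_{123+}=e_1e_2e_3e_+$, etc. $\mathrm{CGA}_+$ is its even subalgebra. Reversion $a\mapsto\tilde a$ is the linear anti-automorphism that reverses the order of products of generators. The real numbers are identified with the scalars of the algebra. Polynomials in $\mathrm{CGA}_+[t]$ have an indeterminate $t$ that commutes with all coefficients. The reversion $\tilde C$ of a polynomial $C$ is obtained by reversing all coefficients. $C\in\mathrm{CGA}_+[t]$ is called a motion polynomial if $C\tilde C=\tilde C C\in\mathbb{R}[t]\setminus\{0\}$; it describes a rational conformal motion. All polynomials are assumed monic, and the linear factors $t-h_i$ occurring in factorizations are motion polynomials. Euclidean motions (rigid body motions) are the special conformal motions given by motion polynomials with coefficients in the subalgebra $\mathbb{DH}\subset\mathrm{CGA}_+$ (isomorphic to the dual quaternions) spanned over $\mathbb{R}$ by $1$, $e_{23}$, $e_{13}$, $e_{12}$, $e_{123+}+e_{123-}$, $e_{1+}+e_{1-}$, $e_{2+}+e_{2-}$, $e_{3+}+e_{3-}$. Quadratic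 means of degree two in $t$. Euclidean equivalence means agreement up to a Euclidean change of coordinates, i.e. conjugation $C\mapsto a\,C\,a^{-1}$ by an $a\in\mathbb{DH}$ with $a\tilde a=\tilde a a\in\mathbb{R}\setminus\{0\}$. Irregular factorizations: a factorization $C=(t-h_1)(t-h_2)$, $h_1,h_2\in\mathrm{CGA}_+$, of a quadratic motion polynomial $C$ is irregular if there exists an index $\ell\in\{1,2\}$ such that the linear remainder polynomial $R=r_1t+r_0$ obtained by dividing either $(t-h_1)\cdots(t-h_\ell)$ or $(t-h_\ell)\cdots(t-h_2)$ by $M:=(t-h_\ell)(t-\tilde h_\ell)$ has a non-invertible leading coefficient $r_1$. Trivial motions: the motion $C=(t-h_1)(t-h_2)$ is called trivial if there is a map $f\colon\mathbb{R}\to\mathbb{R}$ and $h\in\mathrm{CGA}_+$ such that $h\tilde h\in\mathbb{R}$ and $C(t)=f(t)-h$. (This is meant to express that $C$ is a possibly non-linear reparametrization of a simple motion, i.e. of a motion given by a linear motion polynomial.)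
   Formalization: Uniqueness is proved up to Euclidean equivalence and affine reparametrization t → λt+μ (λ ≠ 0), for motions C without a non-constant real polynomial factor, and with (x,y) ≠ (0,0); without these the claim is false, e.g. for C(t+1) or (t-p)(t-p-d(e_+ + e_-)). *)

(* Defs.v *)
From HB Require Import structures.
From mathcomp Require Import all_boot all_order all_algebra all_field.
From mathcomp Require Import reals ring zify.

Set Implicit Arguments.
Unset Strict Implicit.
Unset Printing Implicit Defensive.

Import GRing.Theory Num.Theory.
Local Open Scope ring_scope.

(* Indices 0, 1, 2, 3, 4 of 'I_5 stand for e_1, e_2, e_3, e_+, e_-.  The set  *)
(* A : {set 'I_5} stands for the product of the generators e_i, i \in A,      *)
(* taken in increasing order of i; these 32 products form the basis.          *)

Definition symdiff (A B : {set 'I_5}) : {set 'I_5} :=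
  (A :\: B) :|: (B :\: A).

(* The sign picked up when e_j is moved leftwards past e_i (or, for i = j,    *)
(* when e_i e_i is replaced by its value).                                    *)
Definition gen_sign (R : realType) (i j : 'I_5) : R :=
  if (j < i)%N then -1
  else if (i == j) && (i == 4%N :> nat) then -1 else 1.

Definition blade_sign (R : realType) (A B : {set 'I_5}) : R :=
  \prod_(i in A) \prod_(j in B) gen_sign R i j.

Definition CGA (R : realType) : Type := {ffun {set 'I_5} -> R^o}.

HB.instance Definition _ (R : realType) := Vector.on (CGA R).

Section Algebra.
Variable R : realType.
Implicit Types (A B C D : {set 'I_5}) (x y z : CGA R).

Definition blade A : CGA R := [ffun B => (A == B)%:R].

Definition cga_mul x y : CGA R :=
  [ffun C : {set 'I_5} => \sum_(A : {set 'I_5})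
     blade_sign R A (symdiff A C) * (x A * y (symdiff A C))].

Lemma in_symdiff A B i : (i \in symdiff A B) = (i \in A) (+) (i \in B).
Proof. by rewrite !inE; case: (i \in A); case: (i \in B). Qed.

Lemma symdiffC A B : symdiff A B = symdiff B A.
Proof. by apply/setP => i; rewrite !in_symdiff addbC. Qed.

Lemma symdiffA A B C : symdiff A (symdiff B C) = symdiff (symdiff A B) C.
Proof. by apply/setP => i; rewrite !in_symdiff addbA. Qed.

Lemma symdiffK A : involutive (symdiff A).
Proof. by move=> B; apply/setP => i; rewrite !in_symdiff addKb. Qed.

Lemma symdiff0s A : symdiff set0 A = A.
Proof. by apply/setP => i; rewrite in_symdiff inE. Qed.

Lemma gen_signK i j : gen_sign R i j * gen_sign R i j = 1.
Proof.
by rewrite /gen_sign; do 2?case: ifP => _; rewrite ?mulrNN mulr1.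
Qed.

Lemma prod_symdiff (f : 'I_5 -> R) A B : (forall i, f i * f i = 1) ->
  \prod_(i in symdiff A B) f i = \prod_(i in A) f i * \prod_(i in B) f i.
Proof.
move=> f1.
have mk X : \prod_(i in X) f i = \prod_i (if i \in X then f i else 1).
  by rewrite big_mkcond.
rewrite !mk -big_split /=; apply: eq_bigr => i _.
by rewrite in_symdiff; case: (i \in A); case: (i \in B);
   rewrite /= ?f1 ?mulr1 ?mul1r.
Qed.

Lemma blade_signDl A B C :
  blade_sign R (symdiff A B) C = blade_sign R A C * blade_sign R B C.
Proof.
apply: prod_symdiff => i; rewrite -big_split /= big1 // => j _.
exact: gen_signK.
Qed.

Lemma blade_signDr A B C :
  blade_sign R A (symdiff B C) = blade_sign R A B * blade_sign R A C.
Proof.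
rewrite /blade_sign -big_split /=; apply: eq_bigr => i _.
by apply: prod_symdiff => j; apply: gen_signK.
Qed.

Lemma blade_sign0l A : blade_sign R set0 A = 1.
Proof. by rewrite /blade_sign big_set0. Qed.

Lemma blade_sign0r A : blade_sign R A set0 = 1.
Proof. by rewrite /blade_sign big1 // => i _; rewrite big_set0. Qed.

Lemma cga_mulA : associative cga_mul.
Proof.
have aux1 (s p q u v : R) : s * p * (u * (q * v)) = s * (p * q * (u * v)).
  by ring.
have aux2 (s t u v w : R) :
  s * (t * (u * (v * w))) = t * (s * (u * v) * w) by ring.
move=> x y z; apply/ffunP => D; rewrite !ffunE.
transitivity (\sum_A \sum_B (blade_sign R A B *
   (blade_sign R (symdiff A B) (symdiff (symdiff A B) D) *
     (x A * (y B * z (symdiff (symdiff A B) D))))) : R).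
  apply: eq_bigr => A _; rewrite ffunE !mulr_sumr; apply: eq_bigr => B _.
  rewrite -[in LHS](symdiffK B (symdiff A D)) blade_signDr symdiffK.
  rewrite (symdiffA B) (symdiffC B A) blade_signDl.
  exact: aux1.
transitivity (\sum_A \sum_C (blade_sign R A (symdiff A C) *
   (blade_sign R C (symdiff C D) *
     (x A * (y (symdiff A C) * z (symdiff C D))))) : R).
  apply: eq_bigr => A _; rewrite (reindex_inj (can_inj (symdiffK A))) /=.
  by apply: eq_bigr => C _; rewrite !symdiffK.
rewrite exchange_big /=; apply: eq_bigr => C _; rewrite ffunE.
rewrite mulr_suml mulr_sumr; apply: eq_bigr => A _; exact: aux2.
Qed.

Lemma cga_mul1l : left_id (blade set0) cga_mul.
Proof.
move=> x; apply/ffunP => C; rewrite ffunE (bigD1 set0) //= big1 => [|A A0].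
  by rewrite ffunE eqxx symdiff0s blade_sign0l !mul1r addr0.
by rewrite ffunE eq_sym (negPf A0) mul0r mulr0.
Qed.

Lemma cga_mul1r : right_id (blade set0) cga_mul.
Proof.
have sd A : symdiff A A = set0.
  by apply/setP => i; rewrite in_symdiff addbb inE.
move=> x; apply/ffunP => C; rewrite ffunE (bigD1 C) //= big1 => [|A AC].
  by rewrite sd ffunE eqxx blade_sign0r mul1r mulr1 addr0.
rewrite ffunE; case: eqP => [e|]; last by rewrite !mulr0.
case/eqP: AC; rewrite -(symdiffK A C) -e symdiffC.
by rewrite symdiff0s.
Qed.

Lemma cga_mulDl : left_distributive cga_mul +%R.
Proof.
move=> x y z; apply/ffunP => C; rewrite !ffunE -big_split /=.
by apply: eq_bigr => A _; rewrite !ffunE mulrDl mulrDr.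
Qed.

Lemma cga_mulDr : right_distributive cga_mul +%R.
Proof.
move=> x y z; apply/ffunP => C; rewrite !ffunE -big_split /=.
by apply: eq_bigr => A _; rewrite !ffunE !mulrDr.
Qed.

Lemma cga_one_neq0 : blade set0 != 0 :> CGA R.
Proof.
apply/eqP => /ffunP /(_ set0); rewrite !ffunE eqxx.
by move/eqP; rewrite oner_eq0.
Qed.

HB.instance Definition _ := GRing.Zmodule_isNzRing.Build (CGA R)
  cga_mulA cga_mul1l cga_mul1r cga_mulDl cga_mulDr cga_one_neq0.

Lemma cga_scaleAl (a : R) x y : a *: (x * y) = a *: x * y.
Proof.
apply/ffunP => C; rewrite !ffunE scaler_sumr; apply: eq_bigr => A _.
by rewrite !ffunE /GRing.scale /= mulrCA !mulrA.
Qed.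

Lemma cga_scaleAr (a : R) x y : a *: (x * y) = x * (a *: y).
Proof.
apply/ffunP => C; rewrite !ffunE scaler_sumr; apply: eq_bigr => A _.
by rewrite !ffunE /GRing.scale /= mulrCA; congr (_ * _); rewrite mulrCA.
Qed.

HB.instance Definition _ :=
  GRing.Lmodule_isLalgebra.Build R (CGA R) cga_scaleAl.
HB.instance Definition _ :=
  GRing.Lalgebra_isAlgebra.Build R (CGA R) cga_scaleAr.
HB.instance Definition _ := Algebra_isFalgebra.Build R (CGA R).

Lemma cga1E : 1 = blade set0.
Proof. by []. Qed.

Lemma bladeM A B : blade A * blade B = blade_sign R A B *: blade (symdiff A B).
Proof.
apply/ffunP => C; rewrite [LHS]ffunE (bigD1 A) //= big1 => [|A' A'A]; last first.
  by rewrite ffunE eq_sym (negPf A'A) mul0r mulr0.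
rewrite !ffunE eqxx mul1r addr0 /GRing.scale /=.
have -> : (B == symdiff A C) = (symdiff A B == C).
  by apply/eqP/eqP => [->|<-]; rewrite symdiffK.
by case: eqP => [<-|]; rewrite ?symdiffK // !mulr0.
Qed.

Definition gen (i : 'I_5) : CGA R := blade [set i].

Lemma gen_sqr i : gen i * gen i = (if i == 4%N :> nat then -1 else 1)%:A.
Proof.
rewrite bladeM /blade_sign !big_set1 /gen_sign ltnn eqxx /=.
congr (_ *: blade _); apply/setP => j.
by rewrite in_symdiff addbb inE.
Qed.

Lemma gen_anticomm i j : i != j -> gen i * gen j = - (gen j * gen i).
Proof.
move=> ij; rewrite !bladeM /blade_sign !big_set1 /gen_sign.
rewrite [j == i]eq_sym (negPf ij) /= symdiffC -scaleNr; congr (_ *: _).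
by case: ltngtP ij => [||/val_inj ->]; rewrite ?opprK ?eqxx.
Qed.

Definition e1 : CGA R := gen (@Ordinal 5 0 isT).
Definition e2 : CGA R := gen (@Ordinal 5 1 isT).
Definition e3 : CGA R := gen (@Ordinal 5 2 isT).
Definition ep : CGA R := gen (@Ordinal 5 3 isT).
Definition em : CGA R := gen (@Ordinal 5 4 isT).

(* Reversing a product of k distinct generators takes k(k-1)/2 swaps. *)
Definition reversion x : CGA R :=
  [ffun A : {set 'I_5} => (-1) ^+ 'C(#|A|, 2) * x A].

Lemma reversion_is_linear : linear reversion.
Proof.
by move=> a x y; apply/ffunP => A; rewrite !ffunE mulrDr /GRing.scale /= mulrCA.
Qed.

Lemma reversion_gen i : reversion (gen i) = gen i.
Proof.
apply/ffunP => A; rewrite !ffunE; case: eqP => [<-|_]; last by rewrite mulr0.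
by rewrite cards1 mulr1.
Qed.

Lemma blade_signC A B :
  blade_sign R A B * blade_sign R B A = (-1) ^+ (#|A| * #|B| + #|A :&: B|).
Proof.
rewrite /blade_sign [X in _ * X]exchange_big -big_split /=.
transitivity (\prod_(i in A) ((-1) ^+ #|B| * (if i \in B then -1 else 1) : R)).
  apply: eq_bigr => i _; rewrite -big_split /=.
  have s2 j : gen_sign R i j * gen_sign R j i = -1 * (if j == i then -1 else 1).
    rewrite /gen_sign [j == i]eq_sym; case: eqP => [<-|/eqP ij] /=.
      by rewrite ltnn; case: ifP; rewrite ?mulrNN ?mulr1.
    by case: ltngtP ij => [||/val_inj ->]; rewrite ?mulr1 ?mul1r ?eqxx.
  rewrite (eq_bigr _ (fun j _ => s2 j)) big_split /= prodr_const; congr (_ * _).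
  case: (boolP (i \in B)) => iB.
    by rewrite (bigD1 i) //= eqxx big1 ?mulr1 // => j /andP[_ /negPf ->].
  by rewrite big1 // => j jB; case: eqP jB iB => // -> ->.
rewrite big_split /= prodr_const -exprM mulnC exprD; congr (_ * _).
rewrite -big_mkcondr /= -prodr_const; apply: eq_bigl => i.
by rewrite inE.
Qed.

Lemma card_symdiff A B : (#|symdiff A B| = #|A :\: B| + #|B :\: A|)%N.
Proof.
rewrite cardsU (_ : _ :&: _ = set0) ?cards0 ?subn0 //.
by apply/setP => i; rewrite !inE; case: (i \in A); case: (i \in B).
Qed.

Lemma binD2 n m : ('C(n + m, 2) = 'C(n, 2) + 'C(m, 2) + n * m)%N.
Proof.
elim: n => [|n IHn]; first by rewrite mul0n addn0.
by rewrite addSn !binS !bin1 IHn; lia.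
Qed.

Lemma reversion_signM A B :
  (-1) ^+ 'C(#|symdiff A B|, 2) * blade_sign R A B =
  (-1) ^+ 'C(#|A|, 2) * (-1) ^+ 'C(#|B|, 2) * blade_sign R B A.
Proof.
have sK X Y : blade_sign R X Y * blade_sign R X Y = 1.
  by rewrite -blade_signDl; have -> : symdiff X X = set0;
    [apply/setP => i; rewrite in_symdiff addbb inE | rewrite blade_sign0l].
have -> : blade_sign R A B =
    blade_sign R A B * blade_sign R B A * blade_sign R B A.
  by rewrite -mulrA sK mulr1.
rewrite mulrA; congr (_ * _).
rewrite blade_signC -!exprD -[LHS]signr_odd -[RHS]signr_odd.
congr (_ ^+ _); congr nat_of_bool; rewrite card_symdiff.
rewrite -(cardsID B A) -(cardsID A B) [B :&: A]setIC.
move: #|A :&: B| #|A :\: B| #|B :\: A| => c p q.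
rewrite !binD2 !oddD !oddM !oddD.
by case: (odd c); case: (odd p); case: (odd q);
  case: (odd 'C(c, 2)); case: (odd 'C(p, 2)); case: (odd 'C(q, 2)).
Qed.

Lemma reversionM x y : reversion (x * y) = reversion y * reversion x.
Proof.
have aux (s t u a b v w : R) : s * t = a * b * u ->
  s * (t * (v * w)) = u * (b * w * (a * v)).
  by move=> st; rewrite mulrA st; ring.
apply/ffunP => C; rewrite !ffunE mulr_sumr.
rewrite [RHS](reindex_inj (can_inj (symdiffK C))) /=.
apply: eq_bigr => A _; rewrite !ffunE.
have e : symdiff (symdiff C A) C = A by rewrite symdiffC symdiffK.
rewrite e [symdiff C A]symdiffC; apply: aux.
by have := reversion_signM A (symdiff A C); rewrite symdiffK.
Qed.

Definition CGA_even_basis : seq (CGA R) :=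
  [seq blade A | A <- enum [set A : {set 'I_5} | ~~ odd #|A|]].

Definition CGA_even : {vspace CGA R} := <<CGA_even_basis>>%VS.

Definition DH_basis : seq (CGA R) :=
  [:: 1; e2 * e3; e1 * e3; e1 * e2;
      e1 * e2 * e3 * ep + e1 * e2 * e3 * em;
      e1 * ep + e1 * em; e2 * ep + e2 * em; e3 * ep + e3 * em].

Definition DH : {vspace CGA R} := <<DH_basis>>%VS.

End Algebra.

Arguments e1 {R}.
Arguments e2 {R}.
Arguments e3 {R}.
Arguments ep {R}.
Arguments em {R}.

Section Motions.
Variable R : realType.
Implicit Types (C D : {poly CGA R}) (a h : CGA R).

Definition real_poly (p : {poly R}) : {poly CGA R} :=
  map_poly (in_alg (CGA R)) p.

Definition poly_reversion C : {poly CGA R} := map_poly (@reversion R) C.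

Definition motion_polynomial C : Prop :=
  C \is a polyOver (CGA_even R) /\
  exists p : {poly R}, [/\ p != 0, C * poly_reversion C = real_poly p &
                           poly_reversion C * C = real_poly p].

Definition linear_factor h : {poly CGA R} := 'X - h%:P.

(* Real polynomial factors do not change the motion described by C; the       *)
(* degree of the motion is deg C only if there are none.                      *)
Definition no_real_factor C : Prop :=
  forall (p : {poly R}) D, C = real_poly p * D -> (size p <= 1)%N.

Definition quadratic_euclidean_motion C : Prop :=
  [/\ C \is monic, size C = 3, motion_polynomial C,
      C \is a polyOver (DH R) & no_real_factor C].

(* rmodp divides on the right, p = q * m + r; since the divisor has real      *)
(* coefficients, left division gives the same remainder.                      *)
Definition irregular (h : 'I_2 -> CGA R) : Prop :=
  exists l : 'I_2,
    let M := linear_factor (h l) * linear_factor (reversion (h l)) in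
    let before := \prod_(i < 2 | (i <= l)%N) linear_factor (h i) in
    let after := \prod_(i < 2 | (l <= i)%N) linear_factor (h i) in
    (Pdiv.Ring.rmodp before M)`_1 \isn't a GRing.unit \/
    (Pdiv.Ring.rmodp after M)`_1 \isn't a GRing.unit.

Definition has_irregular_factorization C : Prop :=
  exists h : 'I_2 -> CGA R,
    [/\ forall i, h i \in CGA_even R,
        forall i, motion_polynomial (linear_factor (h i)),
        C = \prod_(i < 2) linear_factor (h i) &
        irregular h].

Definition trivial_motion C : Prop :=
  exists (f : R -> R) (h : CGA R),
    [/\ h \in CGA_even R, exists c : R, h * reversion h = c%:A &
        forall t : R, C.[t%:A] = (f t)%:A - h].

Definition euclidean_equivalent C D : Prop :=
  exists a, [/\ a \in DH R,
                exists c : R, [/\ c != 0, a * reversion a = c%:A &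
                                  reversion a * a = c%:A] &
                D = a%:P * C * (a^-1)%:P].

(* The monic polynomial proportional to C(lam t + mu), when C is monic of     *)
(* degree two.                                                                *)
Definition reparametrize (lam mu : R) C : {poly CGA R} :=
  (lam ^- 2)%:A *: (C \Po (lam%:A *: 'X + mu%:A%:P)).

Definition circular_translation (x y : R) : {poly CGA R} :=
  linear_factor ((x *: e1 + y *: e2) * (em + ep) - e1 * e2)
  * linear_factor (e1 * e2).

End Motions.

(* Main.v *)
(* Write i, j, k for e_23, e_13, e_12, which span a copy H of the quaternions,  *)
(* and eps = e_123 (e_+ + e_-), so that DH = H + eps H with eps central in DH   *)
(* and eps^2 = 0.  A factorization C = (t - h1)(t - h2) is irregular iff        *)
(* h_l + ~h_l - (h1 + h2) is not invertible for some l.  This element lies in   *)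
(* DH, so it equals eps q for some q in H, and reversion gives ~q = -q and      *)
(* h1 + ~h1 = h2 + ~h2 = S.  From h1 h2 = h1 ~h1 - h1 eps q in DH one gets      *)
(* h1 eps = eps P with P in H: in the 2x2 quaternionic matrix model of the even *)
(* subalgebra, the lower left entry of h1 vanishes.  Comparing ~h1 h1 eps with  *)
(* (h1 ~h1) eps shows that P is a root of t^2 - S t + h1 ~h1.  A real P, or     *)
(* q = 0, would give C a real factor; otherwise P = s + p with p imaginary,     *)
(* C ~C real forces p q = - q p, and                                            *)
(*   C = (t - s - p)(t - s + p + eps q).                                        *)
(* Rotating p to a multiple of k and rescaling t turns these polynomials into   *)
(* circular translations.                                                       *)

From HB Require Import structures.
Require Import Defs.
From mathcomp Require Import all_boot all_order all_algebra all_field.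
From mathcomp Require Import reals.
From mathcomp Require Import ssrAC ring lra zify.

Import Order.TTheory GRing.Theory Num.Theory.
Local Open Scope ring_scope.

Set Implicit Arguments.
Unset Strict Implicit.
Unset Printing Implicit Defensive.

(** Both sides of the equivalence are compared with one normal form: [C] equals
    [circular_form s p q], the expansion of (t - s - p)(t - s + p + eps q), for nonzero imaginary
    quaternions [p] and [q] that anticommute.

    [circular_form_of_irregular] brings an irregular factorization to this form. The two carrying
    facts are that a non-unit of DH has no quaternion part ([DH_unit]), and that the first root acts
    on [eps] as a quaternion [P] satisfying a real quadratic equation ([mul_eps_DH],
    [quaternion_root]). Conversely, [circular_form_lhs] shows that every such form is an irregular,
    non-trivial motion: its value at a real t has a positive real part, and its [eps] part varies
    with t.

    [equivalent_circular_form] and [circular_form_equivalent] match normal forms with circular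
    translations. A Euclidean change of coordinates rotates [p] and [q] simultaneously, while its
    translation part is absorbed by [eps]. The pair can therefore be rotated until [p] is a multiple
    of [qk]; then [q] lies in the span of [qi] and [qj], and the length of [p] and the number [s]
    are absorbed by an affine substitution in t.

    Blade coordinates are avoided throughout: multiplication by [eps] is injective on quaternions
    and kills [eps], which is enough to compare the parts of a dual quaternion. *)

Lemma comm_of_anticomm (A : pzRingType) (x y z : A) :
  x * y = - (y * x) -> x * z = - (z * x) -> GRing.comm x (y * z).
Proof.
by move=> xy xz; rewrite /GRing.comm mulrA xy mulNr -mulrA xz mulrN opprK mulrA.
Qed.

(** * Quaternion units, the null vector and the dual unit *)

Section DualQuaternions.
Variable R : realType.
Implicit Types (x y z h u v p q : CGA R) (C D : {poly CGA R}) (a b c d r s : R).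

Definition qi : CGA R := e2 * e3.
Definition qj : CGA R := e1 * e3.
Definition qk : CGA R := e1 * e2.
Definition ninf : CGA R := ep + em.
Definition eps : CGA R := e1 * e2 * e3 * ninf.

Lemma e11 : e1 * e1 = 1 :> CGA R.
Proof. by rewrite gen_sqr /= scale1r. Qed.
Lemma e22 : e2 * e2 = 1 :> CGA R.
Proof. by rewrite gen_sqr /= scale1r. Qed.
Lemma e33 : e3 * e3 = 1 :> CGA R.
Proof. by rewrite gen_sqr /= scale1r. Qed.
Lemma e21 : e2 * e1 = - (e1 * e2) :> CGA R.
Proof. by rewrite gen_anticomm. Qed.
Lemma e31 : e3 * e1 = - (e1 * e3) :> CGA R.
Proof. by rewrite gen_anticomm. Qed.
Lemma e32 : e3 * e2 = - (e2 * e3) :> CGA R.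
Proof. by rewrite gen_anticomm. Qed.

Lemma qiqi : qi * qi = -1.
Proof. by rewrite /qi mulrA -[e2 * e3 * e2]mulrA e32 mulrN mulrA e22 mul1r mulNr e33. Qed.
Lemma qjqj : qj * qj = -1.
Proof. by rewrite /qj mulrA -[e1 * e3 * e1]mulrA e31 mulrN mulrA e11 mul1r mulNr e33. Qed.
Lemma qkqk : qk * qk = -1.
Proof. by rewrite /qk mulrA -[e1 * e2 * e1]mulrA e21 mulrN mulrA e11 mul1r mulNr e22. Qed.
Lemma qiqj : qi * qj = qk.
Proof. by rewrite /qi /qj mulrA -[e2 * e3 * e1]mulrA e31 mulrN mulNr -!mulrA e33 mulr1 e21 opprK. Qed.
Lemma qjqk : qj * qk = qi.
Proof. by rewrite /qk /qj mulrA -[e1 * e3 * e1]mulrA e31 mulrN mulrA e11 mul1r mulNr e32 opprK. Qed.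
Lemma qkqi : qk * qi = qj.
Proof. by rewrite /qk /qi mulrA -[e1 * e2 * e2]mulrA e22 mulr1. Qed.
Lemma qjqi : qj * qi = - qk.
Proof. by rewrite -qjqk mulrA qjqj mulN1r. Qed.
Lemma qkqj : qk * qj = - qi.
Proof. by rewrite -qkqi mulrA qkqk mulN1r. Qed.
Lemma qiqk : qi * qk = - qj.
Proof. by rewrite -qiqj mulrA qiqi mulN1r. Qed.

Lemma ninf2 : ninf * ninf = 0.
Proof.
rewrite /ninf mulrDl !mulrDr /ep /em !gen_sqr /= scale1r scaleN1r.
by rewrite [gen R _ * gen R (@Ordinal 5 3 isT)]gen_anticomm // addrA addrK subrr.
Qed.

Lemma ninf_gen (i : 'I_5) : (i < 3)%N -> ninf * gen R i = - (gen R i * ninf).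
Proof.
move=> i3; rewrite /ninf mulrDl mulrDr opprD /ep /em.
by rewrite !(@gen_anticomm _ _ i) //; apply: contraTneq i3 => <-.
Qed.

Lemma ninf_e1 : ninf * e1 = - (e1 * ninf). Proof. exact: ninf_gen. Qed.
Lemma ninf_e2 : ninf * e2 = - (e2 * ninf). Proof. exact: ninf_gen. Qed.
Lemma ninf_e3 : ninf * e3 = - (e3 * ninf). Proof. exact: ninf_gen. Qed.

(** Otherwise [ep = - em], although these square to 1 and -1. *)
Lemma ninf_neq0 : ninf != 0.
Proof.
apply/eqP => /eqP; rewrite addr_eq0 => /eqP epm.
have := gen_sqr R (@Ordinal 5 3 isT); rewrite -/ep epm mulrNN gen_sqr /=.
move/eqP; rewrite -subr_eq0 -scalerBl scaler_eq0 oner_eq0 orbF => /eqP; lra.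
Qed.

Lemma eps_neq0 : eps != 0.
Proof.
apply: contra ninf_neq0 => /eqP e0.
have : e3 * (e2 * (e1 * eps)) = ninf.
  rewrite /eps -!mulrA [e1 * (e1 * _)]mulrA e11 mul1r [e2 * (e2 * _)]mulrA e22 mul1r.
  by rewrite mulrA e33 mul1r.
by rewrite e0 !mulr0 => <-.
Qed.

Lemma I3_e1 : GRing.comm (e1 * e2 * e3 : CGA R) e1.
Proof.
rewrite /GRing.comm -[in LHS]mulrA e31 mulrN !mulrA -[e1 * e2 * e1]mulrA e21 mulrN.
by rewrite mulNr opprK !mulrA.
Qed.
Lemma I3_e2 : GRing.comm (e1 * e2 * e3 : CGA R) e2.
Proof.
rewrite /GRing.comm -[in LHS]mulrA e32 mulrN !mulrA e21.
by rewrite !mulNr.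
Qed.
Lemma I3_e3 : GRing.comm (e1 * e2 * e3 : CGA R) e3.
Proof.
rewrite /GRing.comm !mulrA e31 mulNr -[e1 * e3 * e2]mulrA e32.
by rewrite mulrN opprK !mulrA.
Qed.

Lemma eps_comm_even (i j : 'I_5) : (i < 3)%N -> (j < 3)%N ->
  GRing.comm (e1 * e2 * e3) (gen R i) -> GRing.comm (e1 * e2 * e3) (gen R j) ->
  GRing.comm eps (gen R i * gen R j).
Proof.
move=> i3 j3 ci cj; apply/commr_sym/commrM; apply/commr_sym.
  exact: commrM.
by apply: comm_of_anticomm; apply: ninf_gen.
Qed.

Lemma eps_qi : eps * qi = qi * eps.
Proof. by apply: eps_comm_even => //; [apply: I3_e2|apply: I3_e3]. Qed.
Lemma eps_qj : eps * qj = qj * eps.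
Proof. by apply: eps_comm_even => //; [apply: I3_e1|apply: I3_e3]. Qed.
Lemma eps_qk : eps * qk = qk * eps.
Proof. by apply: eps_comm_even => //; [apply: I3_e1|apply: I3_e2]. Qed.

Lemma eps2 : eps * eps = 0.
Proof.
have nI : ninf * (e1 * e2 * e3) = - (e1 * e2 * e3 * ninf).
  rewrite !mulrA ninf_e1 !mulNr -(mulrA e1 ninf) ninf_e2 mulrN !mulNr opprK mulrA.
  by rewrite -(mulrA (e1 * e2) ninf) ninf_e3 mulrN mulrA.
by rewrite /eps mulrA -(mulrA _ ninf) nI mulrN mulNr mulrA -(mulrA _ ninf ninf) ninf2 mulr0 oppr0.
Qed.

(** This identity and the next two express the last three elements of [DH_basis] as signed products
    of [eps] with the quaternion units. *)
Lemma e1n : e1 * ninf = - (eps * qi).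
Proof.
rewrite eps_qi /eps mulrA -mulNr; congr (_ * _).
have -> : qi * (e1 * e2 * e3) = e1 * e2 * e3 * qi.
  by apply/commr_sym/commrM; [apply: I3_e2|apply: I3_e3].
by rewrite -(mulrA e1) -mulrA qiqi mulrN1 opprK.
Qed.

Lemma e2n : e2 * ninf = eps * qj.
Proof.
rewrite eps_qj /eps mulrA; congr (_ * _).
rewrite -(mulrA e1) -(mulrA e1 e3) (mulrA e3) e31 mulNr mulrN !mulrA e11 mul1r.
by rewrite e32 mulNr opprK -mulrA e33 mulr1.
Qed.

Lemma e3n : e3 * ninf = - (eps * qk).
Proof. by rewrite eps_qk /eps mulrA mulrA qkqk mulN1r mulNr opprK. Qed.

(** * Quaternion arithmetic, reversion and multiplication by the dual unit *)

Definition quat a b c d : CGA R := a%:A + b *: qi + c *: qj + d *: qk.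

Lemma quatD a b c d a' b' c' d' :
  quat a b c d + quat a' b' c' d' = quat (a + a') (b + b') (c + c') (d + d').
Proof. by rewrite /quat !scalerDl [LHS]addrACA; congr (_ + _); rewrite [LHS]addrACA; congr (_ + _); rewrite addrACA. Qed.

Lemma quatZ s a b c d : s *: quat a b c d = quat (s * a) (s * b) (s * c) (s * d).
Proof. by rewrite /quat !scalerDr !scalerA. Qed.

Lemma quatN a b c d : - quat a b c d = quat (- a) (- b) (- c) (- d).
Proof. by rewrite -scaleN1r quatZ !mulN1r. Qed.

Lemma quat_A a : quat a 0 0 0 = a%:A.
Proof. by rewrite /quat !scale0r !addr0. Qed.

Lemma quat_qi a b c d : quat a b c d * qi = quat (- b) a d (- c).
Proof.
rewrite /quat !mulrDl -!scalerAl mul1r qiqi qjqi qkqi !scalerN !scaleNr.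
by rewrite [LHS](ACl (2*1*4*3)).
Qed.

Lemma quat_qj a b c d : quat a b c d * qj = quat (- c) (- d) a b.
Proof.
rewrite /quat !mulrDl -!scalerAl mul1r qiqj qjqj qkqj !scalerN !scaleNr.
by rewrite [LHS](ACl (3*4*1*2)).
Qed.

Lemma quat_qk a b c d : quat a b c d * qk = quat (- d) c (- b) a.
Proof.
rewrite /quat !mulrDl -!scalerAl mul1r qiqk qjqk qkqk !scalerN !scaleNr.
by rewrite [LHS](ACl (4*3*2*1)).
Qed.

HB.instance Definition _ :=
  GRing.isLinear.Build R (CGA R) (CGA R) _ (@reversion R) (@reversion_is_linear R).

Lemma reversionK : involutive (@reversion R).
Proof. by move=> x; apply/ffunP => A; rewrite !ffunE mulrA -expr2 sqrr_sign mul1r. Qed.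

Lemma reversion1 : reversion 1 = 1 :> CGA R.
Proof.
by rewrite -[LHS]mulr1 -{2}(reversionK 1) -reversionM mulr1 reversionK.
Qed.

Lemma reversion_gen2 (i j : 'I_5) : i != j ->
  reversion (gen R i * gen R j) = - (gen R i * gen R j).
Proof. by move=> ij; rewrite reversionM !reversion_gen gen_anticomm // eq_sym. Qed.

(** Reversing four factors takes six swaps. Hence reversion conjugates both quaternion parts of an
    element of DH. *)
Lemma reversion_eps : reversion eps = eps :> CGA R.
Proof.
have rn : reversion ninf = ninf :> CGA R by rewrite raddfD /= !reversion_gen.
rewrite /eps -mulrA reversionM [reversion (e3 * _)]reversionM rn reversion_gen.
have -> : reversion (e1 * e2) = - (e1 * e2) :> CGA R by exact: reversion_gen2.
rewrite ninf_e3 mulrN mulNr opprK.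
have := comm_of_anticomm (x := ninf) (y := e1) (z := e2 : CGA R).
move=> /(_ (ninf_e1) (ninf_e2)) nc.
have /commr_sym c3 : GRing.comm (e3 : CGA R) (e1 * e2).
  by apply: comm_of_anticomm; rewrite ?e31 ?e32.
by rewrite -[LHS]mulrA nc [LHS]mulrA -c3 -[LHS]mulrA.
Qed.

Lemma eq_quat (a b c d a' b' c' d' : R) : a = a' -> b = b' -> c = c' -> d = d' ->
  quat a b c d = quat a' b' c' d'.
Proof. by move=> -> -> -> ->. Qed.

Lemma quatM a b c d a' b' c' d' :
  quat a b c d * quat a' b' c' d' =
  quat (a * a' - b * b' - c * c' - d * d') (a * b' + b * a' + c * d' - d * c')
      (a * c' - b * d' + c * a' + d * b') (a * d' + b * c' - c * b' + d * a') :> CGA R.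
Proof.
rewrite {2}/quat !mulrDr -!scalerAr mulr1 quat_qi quat_qj quat_qk !quatZ !quatD.
congr quat; ring.
Qed.

Lemma reversion_quat a b c d :
  reversion (quat a b c d) = quat a (- b) (- c) (- d) :> CGA R.
Proof.
by rewrite /quat !raddfD /= !linearZ /= reversion1 !reversion_gen2 // !scalerN !scaleNr.
Qed.

Lemma eps_quat a b c d : eps * quat a b c d = quat a b c d * eps :> CGA R.
Proof.
rewrite /quat !mulrDr !mulrDl -!scalerAr -!scalerAl mulr1 mul1r.
by rewrite eps_qi eps_qj eps_qk.
Qed.

Lemma quat_norm a b c d : quat a b c d * quat a (- b) (- c) (- d) =
  (a ^+ 2 + b ^+ 2 + c ^+ 2 + d ^+ 2)%:A :> CGA R.
Proof. by rewrite quatM -quat_A; congr quat; ring. Qed.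

Lemma eps_scalar_eq0 a : eps * a%:A = 0 :> CGA R -> a = 0.
Proof.
rewrite -scalerAr mulr1 => /eqP; rewrite scaler_eq0 (negPf (eps_neq0)) orbF.
by move/eqP.
Qed.

(** Multiplying by the conjugate quaternion leaves [eps] times a sum of four squares. An equation
    between quaternions is later multiplied by [eps] so that its coordinates can be read off
    here. *)
Lemma eps_quat_eq0 a b c d : eps * quat a b c d = 0 :> CGA R ->
  [/\ a = 0, b = 0, c = 0 & d = 0].
Proof.
move=> e0.
have /eps_scalar_eq0 : eps * (a ^+ 2 + b ^+ 2 + c ^+ 2 + d ^+ 2)%:A = 0 :> CGA R.
  by rewrite -quat_norm mulrA e0 mul0r.
move=> /eqP; rewrite !paddr_eq0 ?addr_ge0 ?sqr_ge0 // !sqrf_eq0.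
by move=> /andP[/andP[/andP[/eqP-> /eqP->] /eqP->] /eqP->].
Qed.

Definition is_quat x := exists a b c d, x = quat a b c d.

Lemma is_quatD x y : is_quat x -> is_quat y -> is_quat (x + y).
Proof.
move=> [a [b [c [d ->]]]] [a' [b' [c' [d' ->]]]]; rewrite quatD.
by do 4!eexists.
Qed.
Lemma is_quatM x y : is_quat x -> is_quat y -> is_quat (x * y).
Proof.
move=> [a [b [c [d ->]]]] [a' [b' [c' [d' ->]]]]; rewrite quatM.
by do 4!eexists.
Qed.
Lemma is_quatZ r x : is_quat x -> is_quat (r *: x).
Proof. by move=> [a [b [c [d ->]]]]; rewrite quatZ; do 4!eexists. Qed.
Lemma is_quatN x : is_quat x -> is_quat (- x).
Proof. by move=> Hx; rewrite -scaleN1r; apply: is_quatZ. Qed.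
Lemma is_quat_A r : is_quat r%:A.
Proof. by rewrite -quat_A; do 4!eexists. Qed.
Lemma is_quat_mk a b c d : is_quat (quat a b c d).
Proof. by do 4!eexists. Qed.
Lemma is_quat0 : is_quat 0.
Proof. by rewrite -(scale0r 1); apply: is_quat_A. Qed.
Lemma is_quat_reversion x : is_quat x -> is_quat (reversion x).
Proof. by move=> [a [b [c [d ->]]]]; rewrite reversion_quat; apply: is_quat_mk. Qed.

Lemma eps_is_quat x : is_quat x -> eps * x = x * eps.
Proof. by move=> [a [b [c [d ->]]]]; apply: eps_quat. Qed.

Lemma eps_is_quat_eq0 x : is_quat x -> eps * x = 0 -> x = 0.
Proof.
move=> [a [b [c [d ->]]]] /eps_quat_eq0 [-> -> -> ->].
by rewrite quat_A scale0r.
Qed.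

Lemma is_quat_norm x : is_quat x -> exists n, [/\ x * reversion x = n%:A,
  reversion x * x = n%:A, 0 <= n & n = 0 -> x = 0].
Proof.
move=> [a [b [c [d ->]]]]; exists (a ^+ 2 + b ^+ 2 + c ^+ 2 + d ^+ 2).
rewrite reversion_quat; split; first exact: quat_norm.
- by rewrite quatM -quat_A; congr quat; ring.
- by rewrite !addr_ge0 ?sqr_ge0.
move=> /eqP; rewrite !paddr_eq0 ?addr_ge0 ?sqr_ge0 // !sqrf_eq0.
move=> /andP[/andP[/andP[/eqP-> /eqP->] /eqP->] /eqP->].
by rewrite quat_A scale0r.
Qed.

Lemma is_quat_inv x : is_quat x -> x != 0 -> exists y, [/\ is_quat y, x * y = 1 & y * x = 1].
Proof.
move=> Hx x0; have [n [xr rx _ n0]] := is_quat_norm Hx.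
have {}n0 : n != 0 by apply: contra x0 => /eqP/n0/eqP.
exists (n^-1 *: reversion x); split; first exact/is_quatZ/is_quat_reversion.
  by rewrite -scalerAr xr scalerA mulVf // scale1r.
by rewrite -scalerAl rx scalerA mulVf // scale1r.
Qed.

Lemma eps_sqr0 x y : is_quat x -> (eps * x) * (eps * y) = 0.
Proof. by move=> Hx; rewrite (eps_is_quat Hx) -mulrA (mulrA eps) eps2 mul0r mulr0. Qed.

(** * Dual quaternions inside the even subalgebra *)

Lemma DHP x : reflect (exists P Q, [/\ is_quat P, is_quat Q & x = P + eps * Q]) (x \in DH R).
Proof.
have bi : DH_basis R = [:: 1; qi; qj; qk; eps; - (eps * qi); eps * qj; - (eps * qk)].
  by rewrite /DH_basis -!mulrDr -e1n -e2n -e3n.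
rewrite /DH bi; apply: (iffP idP).
  rewrite !span_cons span_nil addv0.
  move=> /memv_addP[_ /vlineP[a ->] [_ /memv_addP[_ /vlineP[b ->]
    [_ /memv_addP[_ /vlineP[c ->] [_ /memv_addP[_ /vlineP[d ->]
    [_ /memv_addP[_ /vlineP[a' ->] [_ /memv_addP[_ /vlineP[b' ->]
    [_ /memv_addP[_ /vlineP[c' ->] [_ /vlineP[d' ->] ->]] ->]] ->]] ->]] ->]] ->]] ->]].
  exists (quat a b c d), (quat a' (- b') c' (- d')); split; try exact: is_quat_mk.
  by rewrite /quat !mulrDr -!scalerAr mulr1 !scaleNr !scalerN !addrA.
move=> [_ [_ [[a [b [c [d ->]]]] [a' [b' [c' [d' ->]]]] ->]]].
rewrite /quat !mulrDr -!scalerAr mulr1 -[b' *: (eps * qi)]opprK -scalerN -scaleNr.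
rewrite -[d' *: (eps * qk)]opprK -scalerN -scaleNr.
by do ![apply: rpredD]; apply: memvZ; apply: memv_span; rewrite !inE eqxx ?orbT.
Qed.

Lemma blade_even2 (A B : {set 'I_5}) : odd #|A| = odd #|B| ->
  exists s (D : {set 'I_5}), ~~ odd #|D| /\ blade R A * blade R B = s *: blade R D.
Proof.
move=> AB; exists (blade_sign R A B), (symdiff A B); rewrite bladeM; split=> //.
move: AB; rewrite card_symdiff -(cardsID B A) -(cardsID A B) [B :&: A]setIC !oddD.
by case: (odd _); case: (odd _); case: (odd _).
Qed.

Lemma blade_in_even (D : {set 'I_5}) s : ~~ odd #|D| -> s *: blade R D \in CGA_even R.
Proof.
move=> oD; apply/memvZ/memv_span/mapP; exists D => //.
by rewrite mem_enum inE.
Qed.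

Lemma gen2_even (i j : 'I_5) : gen R i * gen R j \in CGA_even R.
Proof.
have [|s [D [oD ->]]] := @blade_even2 [set i] [set j]; first by rewrite !cards1.
exact: blade_in_even.
Qed.

Lemma gen4_even (i j k l : 'I_5) : gen R i * gen R j * gen R k * gen R l \in CGA_even R.
Proof.
have [|s [D [oD e]]] := @blade_even2 [set i] [set j]; first by rewrite !cards1.
have [|s' [D' [oD' e']]] := @blade_even2 [set k] [set l]; first by rewrite !cards1.
rewrite -mulrA /gen e e' -scalerAl -scalerAr.
have [|s2 [D2 [oD2 ->]]] := @blade_even2 D D'; first by rewrite (negPf oD) (negPf oD').
by apply/memvZ/memvZ/blade_in_even.
Qed.

Lemma DH_sub_even : {subset DH R <= CGA_even R}.
Proof.
suff: (DH R <= CGA_even R)%VS by move/subvP.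
apply/span_subvP => x; rewrite !inE => /or4P[|||/or4P[|||/orP[|]]] /eqP ->.
- by rewrite -[1]scale1r blade_in_even // cards0.
- exact: gen2_even.
- exact: gen2_even.
- exact: gen2_even.
- by apply: rpredD; apply: gen4_even.
- by apply: rpredD; apply: gen2_even.
- by apply: rpredD; apply: gen2_even.
- by apply: rpredD; apply: gen2_even.
Qed.

Lemma even1 : 1 \in CGA_even R.
Proof. by apply/DH_sub_even/memv_span; rewrite inE eqxx. Qed.

(** * Monic quadratics, motion polynomials and irregularity *)

Definition quadratic x y : {poly CGA R} := 'X^2 + x *: 'X + y%:P.

Lemma coef_quadratic x y n : (quadratic x y)`_n = if n is k.+1 then if k is j.+1 then (j == 0%N)%:R else x else y.
Proof.
rewrite /quadratic !coefE.
by case: n => [|[|[|n]]]; rewrite /= ?(mulr0, mulr1, addr0, add0r).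
Qed.

Lemma quadratic_monic_size x y : quadratic x y \is monic /\ size (quadratic x y) = 3.
Proof.
have s3 : size (quadratic x y) = 3.
  rewrite /quadratic -addrA size_polyDl size_polyXn // ltnS.
  rewrite (leq_trans (size_polyD _ _)) // geq_max (leq_trans (size_scale_leq _ _)) ?size_polyX //.
  by rewrite (leq_trans (size_polyC_leq1 _)).
by split=> //; rewrite monicE /lead_coef s3 coef_quadratic.
Qed.

Lemma linear_factorM x y :
  linear_factor x * linear_factor y = quadratic (- (x + y)) (x * y).
Proof.
apply/polyP => i; rewrite /linear_factor mulrBl !mulrBr coefB !coefB coef_quadratic.
rewrite -!polyCM coefC coefCM coefMC -expr2 !coefE.
case: i => [|[|[|i]]]; rewrite /= ?(mulr0, mul0r, subr0, sub0r, opprK, mulr1, mul1r) //.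
- by rewrite oppr0 add0r.
- by rewrite opprD addrC.
- by rewrite oppr0.
Qed.

Lemma conj_quadratic u v x y : u * v = 1 ->
  u%:P * quadratic x y * v%:P = quadratic (u * x * v) (u * y * v).
Proof.
move=> uv; apply/polyP => i; rewrite coefMC coefCM !coef_quadratic.
by case: i => [|[|[|i]]] //=; rewrite ?mulr1 ?mulr0 ?mul0r.
Qed.

Lemma reparametrize_quadratic (lam mu : R) x y : lam != 0 ->
  reparametrize lam mu (quadratic x y) =
  quadratic (lam^-1 *: ((2 * mu)%:A + x)) (lam ^- 2 *: ((mu ^+ 2)%:A + mu *: x + y)).
Proof.
move=> l0; rewrite /reparametrize /quadratic !comp_polyD comp_polyZ comp_polyX comp_polyC.
rewrite comp_Xn_poly [(_ + _) ^+ 2]expr2 mulrDl !mulrDr.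
rewrite -!scalerAl -(commr_polyX (lam%:A *: 'X)) -(commr_polyX (mu%:A)%:P).
rewrite !mul_polyC -scalerAl -expr2.
apply/polyP => i; rewrite !coefE !mulr_algl !scalerA.
case: i => [|[|[|i]]]; rewrite /= ?(mulr0, mulr1, addr0, add0r, scaler0) //.
- by rewrite scalerA -expr2 -scalerAr mulr1.
- rewrite -scalerAr mulr1 -scalerDl.
  have -> : lam * mu + mu * lam = lam * (2 * mu) by ring.
  rewrite -(scalerA lam) -scalerDr scalerA expr2 invfM mulfVK //.
- by rewrite scalerA -expr2 mulVf ?scale1r // expf_neq0.
Qed.

Lemma coef_poly_reversion C i : (poly_reversion C)`_i = reversion C`_i.
Proof. by rewrite coef_map_id0 // raddf0. Qed.

Lemma poly_reversionM C D :
  poly_reversion (C * D) = poly_reversion D * poly_reversion C.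
Proof.
apply/polyP => i; rewrite coef_poly_reversion coefM coefMr raddf_sum /=.
by apply: eq_bigr => j _; rewrite reversionM !coef_poly_reversion.
Qed.

Lemma poly_reversion_linear h :
  poly_reversion (linear_factor h) = linear_factor (reversion h).
Proof.
apply/polyP => i; rewrite coef_poly_reversion !coefB !coefC !coefX raddfB /=.
by case: eqP => _; case: eqP => _; rewrite ?raddf0 ?reversion1 // subr0.
Qed.

Lemma real_poly_comm (p : {poly R}) C : real_poly p * C = C * real_poly p.
Proof.
apply/polyP => i; rewrite coefM coefMr; apply: eq_bigr => j _.
by rewrite coef_map /= -scalerAl -scalerAr mul1r mulr1.
Qed.

Lemma real_quadratic (s n : R) : quadratic s%:A n%:A = real_poly ('X^2 + s *: 'X + n%:P).
Proof.
apply/polyP => i; rewrite coef_quadratic coef_map /= !coefE.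
case: i => [|[|[|i]]]; rewrite /= ?(mulr0, mulr1, addr0, add0r) //.
  by rewrite scale1r.
by rewrite scale0r.
Qed.

Lemma real_quadratic_neq0 (s n : R) : 'X^2 + s *: 'X + n%:P != 0 :> {poly R}.
Proof.
apply/eqP => /polyP /(_ 2%N); rewrite !coefE /= mulr0 !addr0 => /eqP.
by rewrite oner_eq0.
Qed.

Lemma motion_linearP h : motion_polynomial (linear_factor h) ->
  exists s n : R, [/\ h + reversion h = s%:A, h * reversion h = n%:A &
                      reversion h * h = n%:A].
Proof.
move=> [_ [p [_]]]; rewrite poly_reversion_linear !linear_factorM => e e'.
exists (- p`_1), p`_0; split.
- have := congr1 (fun q : {poly CGA R} => q`_1) e.
  by rewrite coef_quadratic coef_map /= scaleNr => <-; rewrite opprK.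
- have := congr1 (fun q : {poly CGA R} => q`_0) e.
  by rewrite coef_quadratic coef_map.
- have := congr1 (fun q : {poly CGA R} => q`_0) e'.
  by rewrite coef_quadratic coef_map.
Qed.

(** One order of the norm suffices: [reversion h] is [s%:A - h], which commutes with [h]. *)
Lemma motion_linear h (s n : R) : h \in CGA_even R ->
   h + reversion h = s%:A -> h * reversion h = n%:A ->
   motion_polynomial (linear_factor h).
Proof.
move=> he hs hn; split.
  apply/polyOverP => i; rewrite coefB coefX coefC.
  by case: i => [|[|i]] /=; rewrite ?subr0 ?sub0r ?rpredN ?rpred0 ?even1.
have hC : reversion h * h = n%:A.
  have -> : reversion h = s%:A - h by rewrite -hs addrAC subrr add0r.
  rewrite -hn; have -> : reversion h = s%:A - h by rewrite -hs addrAC subrr add0r.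
  by rewrite mulrBl mulrBr -scalerAl -scalerAr mulr1 mul1r.
exists ('X^2 + (- s) *: 'X + n%:P); rewrite real_quadratic_neq0 -real_quadratic.
rewrite poly_reversion_linear !linear_factorM; split=> //.
  by rewrite hs hn scaleNr.
by rewrite addrC hs hC scaleNr.
Qed.

(** Real polynomials are central, so norms multiply. Evenness of the product is a hypothesis; for
    circular forms it comes from their coefficients lying in DH. *)
Lemma motion_polynomialM C D : C * D \is a polyOver (CGA_even R) ->
  motion_polynomial C -> motion_polynomial D -> motion_polynomial (C * D).
Proof.
move=> eCD [eC [p [p0 pC pC']]] [eD [q [q0 qD qD']]]; split=> //.
exists (p * q); rewrite mulf_neq0 // /real_poly rmorphM /= -!/(real_poly _).
rewrite poly_reversionM; split=> //.
  by rewrite mulrA -(mulrA C) qD -real_poly_comm -mulrA pC real_poly_comm.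
by rewrite mulrA -(mulrA _ _ C) pC' -mulrA real_poly_comm mulrA qD' real_poly_comm.
Qed.

Lemma rmodp_quadratic x y x' y' :
  (Pdiv.Ring.rmodp (quadratic x y) (quadratic x' y'))`_1 = x - x'.
Proof.
have [m s3] := quadratic_monic_size x' y'.
have -> : quadratic x y = 1 * quadratic x' y' + ((x - x') *: 'X + (y - y')%:P).
  apply/polyP => i; rewrite coef_quadratic mul1r coefD coef_quadratic coefD coefZ coefX coefC.
  case: i => [|[|[|i]]]; rewrite /= ?(mulr0, mulr1, addr0, add0r) // addrC subrK //.
rewrite Pdiv.RingMonic.rmodp_addl_mul_small // ?s3.
  by rewrite coefD coefZ coefX coefC /= mulr1 addr0.
rewrite (leq_ltn_trans (size_polyD _ _)) // gtn_max (leq_ltn_trans (size_scale_leq _ _)) ?size_polyX //.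
by rewrite (leq_ltn_trans (size_polyC_leq1 _)).
Qed.

Lemma rmodp_linear h x y :
  (Pdiv.Ring.rmodp (linear_factor h) (quadratic x y))`_1 = 1.
Proof.
have [m s3] := quadratic_monic_size x y.
rewrite Pdiv.Ring.rmodp_small ?s3 ?size_XsubC //.
by rewrite coefB coefX coefC subr0.
Qed.

(** For each index one of the two partial products is a single linear factor, whose remainder has
    leading coefficient 1. The other is the whole product, and subtracting the divisor from it
    leaves the displayed difference. *)
Lemma irregularP (h : 'I_2 -> CGA R) : irregular h <->
  exists l, h l + reversion (h l) - (h ord0 + h ord_max) \isn't a GRing.unit.
Proof.
have o1 : lift ord0 ord0 = ord_max :> 'I_2 by apply/val_inj.
have pr (P : pred 'I_2) : \prod_(i < 2 | P i) linear_factor (h i) =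
  (if P ord0 then linear_factor (h ord0) else 1) *
  (if P ord_max then linear_factor (h ord_max) else 1).
  by rewrite big_mkcond !big_ord_recl big_ord0 /= mulr1 o1.
have E x y : - x + y = y - x by rewrite addrC.
split=> -[l]; rewrite ?pr.
  case: l => -[|[|//]] l2 /=; rewrite ?mulr1 ?mul1r !linear_factorM !rmodp_quadratic !rmodp_linear ?unitr1 opprK E;
   move=> [] // H.
  - by exists ord0; move: H; have -> : Ordinal l2 = ord0 by apply: val_inj.
  - by exists ord_max; move: H; have -> : Ordinal l2 = ord_max by apply: val_inj.
move=> H; exists l; rewrite /= !pr.
case: l H => -[|[|//]] l2 /=; rewrite ?mulr1 ?mul1r !linear_factorM !rmodp_quadratic opprK E.
  by right.
by left.
Qed.

(** * The normal form and its properties *)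

(** For imaginary quaternions, anticommuting means being orthogonal. *)
Definition circular_pair p q :=
  [/\ is_quat p, is_quat q, reversion p = - p, reversion q = - q & p * q = - (q * p)].

(** The product (t - s - p)(t - s + p + eps q), stored by its coefficients because conjugation and
    comparison act on coefficients. *)
Definition circular_form s p q : {poly CGA R} :=
  quadratic (eps * q - (2 * s)%:A) (- (p * p) - s *: (eps * q) - eps * (p * q) + (s ^+ 2)%:A).

Lemma circular_form_factor s p q : is_quat p -> circular_form s p q =
  linear_factor (p + s%:A) * linear_factor (- p - eps * q + s%:A).
Proof.
move=> Hp; rewrite linear_factorM /circular_form; congr quadratic.
  rewrite addrACA (addrA p) subrr add0r opprD opprK -scalerDl.
  by congr (_ - _ *: _); ring.
rewrite mulrDl !mulrDr -!scalerAl -!scalerAr !mulr1 !mul1r scalerA -(expr2 s).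
rewrite !mulrN !scalerN (mulrA p) -(eps_is_quat Hp) -(mulrA eps).
move: (s *: p) (s ^+ 2)%:A (p * p) (s *: (eps * q)) (eps * (p * q)) => sp s2 pp a b.
by rewrite [RHS](AC (3*3) (1*5*2*(3*4)*6)) /= subrr addr0.
Qed.

Lemma imaginary_sqr p : is_quat p -> reversion p = - p ->
  exists n, [/\ p * p = - n%:A, 0 <= n & n = 0 -> p = 0].
Proof.
move=> Hp rp; have [n [+ _ n0 pn]] := is_quat_norm Hp; rewrite rp mulrN => e.
by exists n; split=> //; rewrite -e opprK.
Qed.

Lemma is_quat_DH p q : is_quat p -> is_quat q -> p + eps * q \in DH R.
Proof. by move=> Hp Hq; apply/DHP; exists p, q. Qed.

Lemma DH_is_quat p : is_quat p -> p \in DH R.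
Proof. by move=> Hp; rewrite -[p]addr0 -(mulr0 eps) is_quat_DH //; apply: is_quat0. Qed.

Lemma DH_eps q : is_quat q -> eps * q \in DH R.
Proof. by move=> Hq; rewrite -[_ * _]add0r is_quat_DH //; apply: is_quat0. Qed.

Lemma DH_A a : a%:A \in DH R.
Proof. exact/DH_is_quat/is_quat_A. Qed.

Lemma quadratic_polyOver (V : {vspace CGA R}) x y : 1 \in V -> x \in V -> y \in V ->
  quadratic x y \is a polyOver V.
Proof.
move=> V1 Vx Vy; apply/polyOverP => i; rewrite coef_quadratic.
by case: i => [|[|[|i]]] //=; apply: rpred0.
Qed.

Lemma circular_form_DH s p q : is_quat p -> is_quat q -> circular_form s p q \is a polyOver (DH R).
Proof.
move=> Hp Hq; apply: quadratic_polyOver.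
- by rewrite -[1]scale1r DH_A.
- by rewrite rpredB ?DH_A ?DH_eps.
rewrite rpredD ?DH_A // rpredB //; last exact/DH_eps/is_quatM.
rewrite rpredB //; last exact/rpredZ/DH_eps.
by rewrite rpredN; apply/DH_is_quat/is_quatM.
Qed.

Section CircularForm.
Variables (s : R) (p q : CGA R).
Hypothesis pq : circular_pair p q.

(** Up to the shift by [s], the two roots are [p] and [- p - eps * q]. Reversion negates both, and
    both have the same real square, since the cross terms [eps * (p * q + q * p)] cancel. *)
Lemma circular_form_motion : motion_polynomial (circular_form s p q) /\
  (motion_polynomial (linear_factor (p + s%:A)) /\
  motion_polynomial (linear_factor (- p - eps * q + s%:A))).
Proof.
have [Hp Hq rp rq pqC] := pq.
have [n [pp _ _]] := imaginary_sqr Hp rp.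
have H (x : CGA R) : x \in DH R -> reversion x = - x -> x * x = - n%:A ->
    motion_polynomial (linear_factor (x + s%:A)).
  move=> Dx rx xx; apply: (@motion_linear _ (2 * s) (n + s ^+ 2)).
  - by apply: DH_sub_even; rewrite rpredD ?DH_A.
  - rewrite raddfD /= linearZ /= reversion1 rx addrACA subrr add0r -scalerDl.
    by congr (_ *: _); ring.
  - rewrite raddfD /= linearZ /= reversion1 rx mulrDl !mulrDr mulrN xx opprK.
    rewrite -!scalerAl -!scalerAr mulr1 !mul1r scalerA -expr2 scalerN addrA addrK.
    by rewrite -scalerDl.
have M1 : motion_polynomial (linear_factor (p + s%:A)) by apply: H => //; apply: DH_is_quat.
have M2 : motion_polynomial (linear_factor (- p - eps * q + s%:A)).
  apply: H; first by apply: rpredB; [rewrite rpredN; apply: DH_is_quat|apply: DH_eps].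
    by rewrite raddfB /= raddfN /= rp reversionM rq reversion_eps mulNr -(eps_is_quat Hq) opprB !opprK addrC.
  rewrite -opprD mulrNN mulrDl !mulrDr (eps_sqr0 _ Hq) addr0 pp.
  by rewrite (mulrA p) -(eps_is_quat Hp) -(mulrA eps p) -(mulrA eps q) pqC mulrN addrNK.
split=> //; rewrite circular_form_factor //; apply: motion_polynomialM => //.
rewrite -circular_form_factor //; apply/polyOverP => i.
by apply: DH_sub_even; move: i; apply/polyOverP/circular_form_DH.
Qed.

End CircularForm.

Lemma dual_eq0 x y : is_quat x -> is_quat y -> x + eps * y = 0 -> x = 0 /\ y = 0.
Proof.
move=> Hx Hy xy0; have x0 : x = 0.
  apply: eps_is_quat_eq0 => //; have := congr1 (fun z => eps * z) xy0.
  by rewrite /= mulrDr mulrA eps2 mul0r addr0 mulr0.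
by split=> //; apply: eps_is_quat_eq0 => //; rewrite x0 add0r in xy0.
Qed.

Lemma scalar_eq0 a : a%:A = 0 :> CGA R -> a = 0.
Proof. by move/eqP; rewrite scaler_eq0 oner_eq0 orbF => /eqP. Qed.

Lemma horner_quadratic x y r : (quadratic x y).[r%:A] = (r ^+ 2)%:A + r *: x + y.
Proof.
rewrite /quadratic !hornerD hornerXn hornerZ hornerX hornerC expr2 -scalerAl mul1r scalerA -expr2.
by rewrite -scalerAr mulr1.
Qed.

(** Degrees add despite zero divisors in the algebra, because a nonzero real leading coefficient
    cannot annihilate the other one. *)
Lemma real_poly_size_mul (f : {poly R}) D : f != 0 -> D != 0 ->
  size (real_poly f * D) = (size f + size D).-1.
Proof.
move=> f0 D0; rewrite size_proper_mul; first by rewrite size_map_poly.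
by rewrite lead_coef_map /= -scalerAl mul1r scaler_eq0 !lead_coef_eq0 negb_or f0.
Qed.

Section CircularMotion.
Variables (s : R) (p q : CGA R).
Hypothesis pq : circular_pair p q.
Hypotheses (p0 : p != 0) (q0 : q != 0).

(** Completing the square in t - s, with [n] the squared length of [p], separates a positive real
    part from the [eps] part. *)
Lemma circular_form_horner : exists n, 0 < n /\ forall t,
  (circular_form s p q).[t%:A] = ((t - s) ^+ 2 + n)%:A + eps * ((t - s) *: q - p * q).
Proof.
have [Hp Hq rp rq pqC] := pq.
have [n [pp n0 pn]] := imaginary_sqr Hp rp.
exists n; split; first by rewrite lt_def n0 andbT; apply: contra p0 => /eqP/pn/eqP.
move=> t; rewrite horner_quadratic pp opprK scalerBr scalerA mulrBr -scalerAr.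
have -> : ((t - s) ^+ 2 + n)%:A = (t ^+ 2)%:A - (t * (2 * s))%:A + n%:A + (s ^+ 2)%:A :> CGA R.
  by rewrite -scalerBl -!scalerDl; congr (_ *: _); ring.
rewrite scalerBl.
move: (t ^+ 2)%:A (t *: (eps * q)) (t * (2 * s))%:A n%:A (s *: (eps * q)) (eps * (p * q)) (s ^+ 2)%:A => a b c d e f g.
by rewrite !addrA [LHS](ACl (1*3*4*7*2*5*6)).
Qed.

Lemma circular_form_no_real_factor : no_real_factor (circular_form s p q).
Proof.
have [Hp Hq rp rq pqC] := pq.
have [n [n0 hC]] := circular_form_horner.
move=> f D e; rewrite leqNgt; apply/negP => f1.
have [_ s3] := quadratic_monic_size (eps * q - (2 * s)%:A) (- (p * p) - s *: (eps * q) - eps * (p * q) + (s ^+ 2)%:A).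
have f0 : f != 0 by rewrite -size_poly_gt0; apply: ltn_trans f1.
have D0 : D != 0.
  by apply/eqP => D0; move: s3; rewrite -/(circular_form s p q) e D0 mulr0 size_poly0.
have sD : (0 < size D)%N by rewrite size_poly_gt0.
rewrite -/(circular_form s p q) e real_poly_size_mul // in s3.
(* A linear real factor has a real root, at which the real part of the value would have to
   vanish. *)
have [f2|f2] := eqVneq (size f) 2%N.
  have [r /rootP fr] := poly2_root f2.
  have := hC r; rewrite e hornerM_comm; last first.
    by rewrite /comm_poly -scalerAl -scalerAr mul1r mulr1.
  rewrite (_ : (real_poly f).[r%:A] = (f.[r])%:A); last exact: (horner_map (in_alg (CGA R))).
  rewrite fr scale0r mul0r => /esym/dual_eq0 [].
  - exact: is_quat_A.
  - by apply/is_quatD/is_quatN/is_quatM => //; apply: is_quatZ.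
  by move=> /scalar_eq0 H _; have := sqr_ge0 (r - s); lra.
(* Otherwise the cofactor is a constant, real because the form is monic; the linear coefficient
   would then be real, forcing [q = 0]. *)
have /size_poly1P[d _ De] : size D == 1%N by lia.
have fd i : (circular_form s p q)`_i = f`_i *: d.
  by rewrite e De coefMC coef_map /= mulr_algl.
have /= := fd 2%N; rewrite coef_quadratic /= => d1.
have f20 : f`_2 != 0 by apply/eqP => f20; move/eqP: d1; rewrite f20 scale0r oner_eq0.
have {}d1 : d = (f`_2)^-1%:A by rewrite -[LHS]scale1r -(mulVf f20) -scalerA -d1.
have := fd 1%N; rewrite coef_quadratic d1 scalerA => /eqP; rewrite -subr_eq0 -addrA -opprD -scalerDl addrC -scaleNr.
move=> /eqP /dual_eq0 [] //; first exact: is_quat_A.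
by move=> _ /eqP; rewrite (negPf q0).
Qed.

Lemma circular_form_nontrivial : ~ trivial_motion (circular_form s p q).
Proof.
have [Hp Hq rp rq pqC] := pq.
have [n [n0 hC]] := circular_form_horner.
move=> [f [h [_ _ fh]]].
have := fh s; have := fh (s + 1); rewrite !hC subrr scale0r sub0r.
rewrite (_ : s + 1 - s = 1); last by ring.
rewrite scale1r => e1 e0.
(* The difference of the values at [s + 1] and [s] is real by triviality, yet its [eps] part is
   [eps * q]. *)
have : (1 + f s - f (s + 1))%:A + eps * q = 0.
  have := congr2 (fun x y => x - y) e1 e0.
  rewrite opprB addrA addrNK mulrBr mulrN !opprD !opprK addrACA addrNK -scalerBl -scalerBl.
  move=> e.
  have -> : 1 + f s - f (s + 1) = 1 ^+ 2 + n - (0 ^+ 2 + n) - (f (s + 1) - f s) by ring.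
  by rewrite scalerBl addrAC e subrr.
move=> /dual_eq0 [] //; first exact: is_quat_A.
by move=> _ /eqP; rewrite (negPf q0).
Qed.

Lemma circular_form_irregular : has_irregular_factorization (circular_form s p q).
Proof.
have [Hp Hq rp rq pqC] := pq.
have [_ [M1 M2]] := circular_form_motion s pq.
exists (fun i => if i == ord0 then p + s%:A else - p - eps * q + s%:A); split.
- by move=> i; case: ifP => _; [case: M1|case: M2] => + _ => /polyOverP /(_ 0%N);
   rewrite coefB coefX coefC sub0r rpredN.
- by move=> i; case: ifP.
- rewrite big_ord_recl big_ord_recl big_ord0 /= mulr1.
  exact: circular_form_factor.
apply/irregularP; exists ord0; rewrite /=.
rewrite raddfD /= linearZ /= reversion1 rp.
have -> : p + s%:A + (- p + s%:A) - (p + s%:A + (- p - eps * q + s%:A)) = eps * q.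
  rewrite opprD addrACA subrr add0r opprD opprD !opprK.
  by rewrite [LHS](AC (2*3) ((1*3)*(2*5)*4)) /= addNr subrr !add0r.
(* The relevant element [eps * q] squares to zero, so as a unit it would vanish. *)
apply/negP => /mulrI /(_ (eps * q) 0); rewrite (eps_sqr0 _ Hq) mulr0 => /(_ erefl) /eps_is_quat_eq0.
by move=> /(_ Hq) /eqP; rewrite (negPf q0).
Qed.

Lemma circular_form_lhs : quadratic_euclidean_motion (circular_form s p q) /\
  ~ trivial_motion (circular_form s p q) /\
   has_irregular_factorization (circular_form s p q).
Proof.
have [Hp Hq rp rq pqC] := pq.
split; last by split; [apply: circular_form_nontrivial|apply: circular_form_irregular].
have [mC sC] := quadratic_monic_size (eps * q - (2 * s)%:A) (- (p * p) - s *: (eps * q) - eps * (p * q) + (s ^+ 2)%:A).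
split=> //; first by case: (circular_form_motion s pq).
  exact: circular_form_DH.
exact: circular_form_no_real_factor.
Qed.
End CircularMotion.

(** * From an irregular factorization to the normal form *)

(** Factoring out [x] leaves [1 + w] with [w] of square zero, whose inverse is [1 - w]. *)
Lemma DH_unit x y : is_quat x -> is_quat y -> x != 0 -> x + eps * y \is a GRing.unit.
Proof.
move=> Hx Hy x0; have [z [Hz xz zx]] := is_quat_inv Hx x0.
set w := eps * (z * y).
have ww : w * w = 0 by apply/eps_sqr0/is_quatM.
have -> : x + eps * y = x * (1 + w).
  by rewrite mulrDr mulr1 /w (mulrA x) -(eps_is_quat Hx) -(mulrA eps) (mulrA x) xz mul1r.
apply/unitrP; exists ((1 - w) * z); split.
  by rewrite mulrA -(mulrA _ z) zx mulr1 mulrBl mul1r mulrDr ww addr0 mulr1 addrK.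
by rewrite mulrA -(mulrA x) mulrDl mul1r mulrBr ww subr0 mulr1 subrK mulr1.
Qed.

(** A non-unit of DH has the form [eps * q]. Adding its reversion gives [S0 + S1 = 2 * S] and shows
    [q] imaginary; since [S] is one of the two traces, they coincide. *)
Lemma irregular_sum (h0 h1 : CGA R) S0 S1 S : h0 + h1 \in DH R ->
  h0 + reversion h0 = S0%:A -> h1 + reversion h1 = S1%:A ->
  S = S0 \/ S = S1 -> S%:A - (h0 + h1) \isn't a GRing.unit ->
  S0 = S /\ exists q, [/\ is_quat q, reversion q = - q & h0 + h1 = S%:A - eps * q].
Proof.
move=> Dh e0 e1 SS nu.
have /DHP [P [q [HP Hq e]]] : S%:A - (h0 + h1) \in DH R by rewrite rpredB ?DH_A.
have P0 : P = 0.
  by apply/eqP; apply: contraNT nu => P0; rewrite e DH_unit.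
rewrite P0 add0r in e.
have : (S0 + S1 - 2 * S)%:A + eps * (q + reversion q) = 0.
  rewrite mulrDr.
  have -> : eps * reversion q = reversion (eps * q).
    by rewrite reversionM reversion_eps (eps_is_quat (is_quat_reversion Hq)).
  rewrite -e [reversion (_ - _)]raddfB /= linearZ /= reversion1 [reversion (h0 + h1)]raddfD /=.
  have -> : S%:A - (h0 + h1) + (S%:A - (reversion h0 + reversion h1)) =
      (S + S - (S0 + S1))%:A.
    by rewrite addrACA -opprD [X in _ - X]addrACA e0 e1 -!scalerDl -scalerBl.
  by rewrite -scalerDl -[RHS](scale0r 1); congr (_ *: _); ring.
move=> /dual_eq0 []; [exact: is_quat_A|exact/is_quatD/is_quat_reversion|].
move=> /scalar_eq0 SE /eqP; rewrite addrC addr_eq0 => /eqP rq.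
split; first by case: SS; lra.
by exists q; split=> //; rewrite -e opprB [RHS]addrC subrK.
Qed.

(** Dividing by [q] puts [h * eps] into DH. Its quaternion part vanishes because [h * eps] is killed
    by [eps] on the right. *)
Lemma mul_eps_DH h q : is_quat q -> q != 0 -> h * (eps * q) \in DH R ->
  exists P, is_quat P /\ h * eps = eps * P.
Proof.
move=> Hq q0 /DHP [A [B [HA HB e]]].
have [z [Hz qz zq]] := is_quat_inv Hq q0.
have e' : h * eps = A * z + eps * (B * z).
  have := congr1 (fun x => x * z) e; rewrite /= mulrDl -(mulrA h) -(mulrA eps) qz mulr1.
  by rewrite -(mulrA eps).
exists (B * z); split; first exact: is_quatM.
rewrite e'; suff -> : A * z = 0 by rewrite add0r.
apply: eps_is_quat_eq0; first exact: is_quatM.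
have := congr1 (fun x => x * eps) e'.
rewrite /= -(mulrA h) eps2 mulr0 mulrDl -(eps_is_quat (is_quatM HA Hz)) (eps_is_quat (is_quatM HB Hz)).
by rewrite -(mulrA (B * z)) eps2 mulr0 addr0.
Qed.

Lemma quaternion_root S n x : is_quat x -> S *: x - x * x = n%:A ->
  (exists r, x = r%:A) \/
  exists s p, [/\ S = 2 * s, x = p + s%:A, is_quat p, reversion p = - p & p != 0] /\
     exists m, [/\ p * p = - m%:A, 0 < m & n = s ^+ 2 + m].
Proof.
move=> [a [b [c [d ->]]]] e.
have : eps * (S *: quat a b c d - quat a b c d * quat a b c d - n%:A) = 0.
  by rewrite e subrr mulr0.
rewrite -quat_A quatM quatZ !quatN !quatD => /eps_quat_eq0 [e1 eb ec ed].
have E : quat a b c d = quat 0 b c d + a%:A :> CGA R.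
  by rewrite -quat_A quatD !addr0 add0r.
have [z|nz] := eqVneq (quat 0 b c d : CGA R) 0.
  by left; exists a; rewrite E z add0r.
right; exists a, (quat 0 b c d).
have rz : reversion (quat 0 b c d) = - quat 0 b c d :> CGA R.
  by rewrite reversion_quat quatN oppr0.
have [m [mm m0 mz]] := imaginary_sqr (is_quat_mk 0 b c d) rz.
(* The imaginary coordinates of the equation are [S - 2 * a] times [b], [c] and [d], which are not
   all zero. *)
have Sa : S = 2 * a.
  apply/eqP; apply: contraNT nz => Sa; apply/eqP.
  have k0 (k : R) : (S - 2 * a) * k = 0 -> k = 0.
    by move=> /eqP; rewrite mulf_eq0 subr_eq0 (negPf Sa) => /eqP.
  have b0 : b = 0 by apply: k0; rewrite -[RHS]eb; ring.
  have c0 : c = 0 by apply: k0; rewrite -[RHS]ec; ring.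
  have d0 : d = 0 by apply: k0; rewrite -[RHS]ed; ring.
  by rewrite b0 c0 d0 quat_A scale0r.
have m1 : 0 < m by rewrite lt_def m0 andbT; apply: contra nz => /eqP/mz/eqP.
split.
  by split=> //; apply: is_quat_mk.
exists m; split=> //.
have := quat_norm 0 b c d; rewrite -reversion_quat rz mulrN mm opprK => /eqP.
rewrite -subr_eq0 -scalerBl => /eqP/scalar_eq0 mE.
have -> : m = 0 ^+ 2 + b ^+ 2 + c ^+ 2 + d ^+ 2 by apply/eqP; rewrite -subr_eq0 mE.
apply/eqP; rewrite -subr_eq0 -oppr_eq0 -[X in _ == X]e1 Sa; apply/eqP; ring.
Qed.

Lemma no_real_factor_linear r h :
  ~ no_real_factor (linear_factor r%:A * linear_factor h).
Proof.
move=> /(_ ('X - r%:P) (linear_factor h)); rewrite size_XsubC => H.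
suff: (2 <= 1)%N by [].
apply: H; congr (_ * _); rewrite /real_poly rmorphB /= map_polyX map_polyC.
by [].
Qed.

Lemma no_real_factor_quadratic (r n : R) : ~ no_real_factor (quadratic r%:A n%:A).
Proof.
move=> /(_ ('X^2 + r *: 'X + n%:P) 1); rewrite real_quadratic mulr1 => /(_ erefl).
by rewrite -addrA size_polyDl ?size_polyXn // ltnS (leq_trans (size_polyD _ _)) // geq_max
  (leq_trans (size_scale_leq _ _)) ?size_polyX // (leq_trans (size_polyC_leq1 _)).
Qed.

Lemma motion_quadratic_norm x y : motion_polynomial (quadratic x y) ->
  exists n : R, y * reversion y = n%:A.
Proof.
move=> [_ [f [_ + _]]] => /polyP /(_ 0%N).
by rewrite coef0M coef_poly_reversion coef_quadratic coef_map => e; exists f`_0.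
Qed.

Lemma circular_form_of_irregular C : quadratic_euclidean_motion C ->
  has_irregular_factorization C ->
  exists s p q, [/\ circular_pair p q, p != 0, q != 0 & C = circular_form s p q].
Proof.
move=> [mC sC MC DC nC] [h [he hM hC /irregularP [l nu]]].
have {}hC : C = linear_factor (h ord0) * linear_factor (h ord_max).
  rewrite hC big_ord_recl big_ord_recl big_ord0 /= mulr1.
  by congr (_ * linear_factor (h _)); apply: val_inj.
have [S0 [n0 [hS0 hn0 hn0']]] := motion_linearP (hM ord0).
have [S1 [n1 [hS1 _ _]]] := motion_linearP (hM ord_max).
have ll : l = ord0 \/ l = ord_max.
  by case: (l) => -[|[|//]] ?; [left|right]; apply: val_inj.
(* Naming the trace of the offending factor [S] treats both indices at once. *)
have [S [SS hSl]] : exists S, (S = S0 \/ S = S1) /\ h l + reversion (h l) = S%:A.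
  by case: ll => ->; [exists S0|exists S1]; split=> //; [left|right].
rewrite {}hSl in nu; move: (h ord0) (h ord_max) nu hS0 hn0 hn0' hS1 hC => h0 h1 nu hS0 hn0 hn0' hS1 hC.
clear h he hM ll l; rewrite linear_factorM in hC.
have D1 : h0 + h1 \in DH R.
  by have /polyOverP /(_ 1%N) := DC; rewrite hC coef_quadratic rpredN.
have D0 : h0 * h1 \in DH R.
  by have /polyOverP /(_ 0%N) := DC; rewrite hC coef_quadratic.
have [SE [q [Hq rq hs]]] := irregular_sum D1 hS0 hS1 SS nu.
subst S0.
have h1E : h1 = reversion h0 - eps * q.
  have -> : h1 = S%:A - eps * q - h0 by rewrite -hs addrAC subrr add0r.
  by rewrite -hS0 addrAC; congr (_ - _); rewrite addrAC subrr add0r.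
have hp : h0 * h1 = n0%:A - h0 * (eps * q) by rewrite h1E mulrBr hn0.
have hC' : C = quadratic (eps * q - S%:A) (n0%:A - h0 * (eps * q)).
  by rewrite hC hs hp opprB.
(* If [q = 0], then [C] itself is a real polynomial. *)
have [q0|q0] := eqVneq q 0.
  by case: (@no_real_factor_quadratic (- S) n0); move: nC; rewrite hC' q0 !mulr0 subr0 sub0r scaleNr.
have [P [HP hP]] : exists P, is_quat P /\ h0 * eps = eps * P.
  apply: (mul_eps_DH Hq q0).
  have -> : h0 * (eps * q) = n0%:A - h0 * h1 by rewrite hp opprB addrC subrK.
  by rewrite rpredB ?DH_A.
(* On multiples of [eps], left multiplication by [h0] is multiplication by [P], so the relation
   [reversion h0 * h0 = n0%:A] with [reversion h0 = S%:A - h0] transfers to [P]. *)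
have Pn : S *: P - P * P = n0%:A.
  apply/eqP; rewrite -subr_eq0; apply/eqP; apply: eps_is_quat_eq0.
    by apply/is_quatD/is_quatN/is_quat_A/is_quatD/is_quatN/is_quatM => //; apply: is_quatZ.
  rewrite !mulrBr -scalerAr (mulrA eps P P) -hP -(mulrA h0 eps P) -hP.
  have -> : eps * n0%:A = reversion h0 * (h0 * eps).
    by rewrite mulrA hn0' -scalerAr -scalerAl mulr1 mul1r.
  have -> : reversion h0 = S%:A - h0 by rewrite -hS0 addrAC subrr add0r.
  by rewrite mulrBl -scalerAl mul1r subrr.
rewrite (mulrA h0) hP -(mulrA eps) in hC'.
have [[r Pr]|[s [p [[SE Pp Hp rp p0] [m [pp m0 nE]]]]]] := quaternion_root HP Pn.
  (* A real [P] makes t - r a factor of [C]; the other root is found by comparing linear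
     coefficients. *)
  case: (@no_real_factor_linear r ((S - r)%:A - eps * q)).
  move: nC; rewrite hC' linear_factorM; congr (no_real_factor (quadratic _ _)).
    by rewrite addrA -scalerDl opprB; congr (_ - _ *: _); ring.
  rewrite Pr mulrBr -!scalerAl mul1r -scalerAr mul1r scalerA -Pn Pr.
  by rewrite -scalerAl mul1r !scalerA -scalerBl mul1r; congr (_ *: _ - _); ring.
exists s, p, q; split=> //; last first.
  rewrite hC' SE /circular_form; congr quadratic.
  rewrite Pp pp opprK mulrDl mulrDr -scalerAl mul1r -scalerAr nE scalerDl.
  by rewrite opprD [LHS](AC (2*2) (2*4*3*1)).
split=> //.
(* It remains to see that [p] and [q] anticommute. The norm of the constant coefficient is real, so
   its [eps] part, a multiple of [P * q + reversion (P * q)], vanishes. *)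
rewrite hC' in MC; have [k] := motion_quadratic_norm MC.
rewrite raddfB /= linearZ /= reversion1 reversionM reversion_eps.
have HPq : is_quat (P * q) by apply: is_quatM.
have HrPq := is_quat_reversion HPq.
rewrite -(eps_is_quat HrPq) mulrBl !mulrBr (eps_sqr0 _ HPq) subr0 -!scalerAl -!scalerAr mul1r mulr1.
move=> e.
have /dual_eq0 [] : (n0 * n0 - k)%:A + eps * (- n0 *: (P * q + reversion (P * q))) = 0.
- rewrite scalerBl -scalerA -e mul1r -scalerAr mulrDr scaleNr scalerDr -addrA -opprD.
  by rewrite addrA !subrK subrr.
- exact: is_quat_A.
- by apply/is_quatZ/is_quatD.
(* The factor [n0 = s ^+ 2 + m] is positive and can be cancelled; the terms with [s] drop out,
   leaving [p * q + q * p = 0]. *)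
move=> _ /eqP; rewrite scaler_eq0 oppr_eq0 gt_eqF ?nE ?ltr_wpDl ?sqr_ge0 //=.
rewrite Pp reversionM raddfD /= linearZ /= reversion1 rp rq.
rewrite mulNr mulrDr mulrDl mulrN -scalerAl -scalerAr mul1r mulr1 opprD opprK.
rewrite addrACA subrr addr0 addr_eq0 => /eqP ->.
by [].
Qed.

(** * Circular translations and Euclidean equivalence *)

(** The [eps] summand sits in the first factor of [circular_translation] and in the second factor of
    the normal form. The two products agree because [w0] anticommutes with [qk]. The substitution
    divides roots by [lam] after shifting them by [- mu]. *)
Lemma reparametrize_circular_translation lam mu (x y : R) : lam != 0 ->
  reparametrize lam mu (circular_translation x y) =
  circular_form (- (mu / lam)) (- lam^-1 *: qk) (- lam^-1 *: quat 0 (- x) y 0).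
Proof.
move=> l0; set w0 := quat 0 (- x) y 0.
have wE : (x *: e1 + y *: e2) * (em + ep) = eps * w0.
  rewrite [em + ep]addrC mulrDl -!scalerAl e1n e2n /w0 /quat !scale0r add0r addr0.
  by rewrite mulrDr -!scalerAr scalerN scaleNr.
have kw : qk * w0 = - (w0 * qk).
  have -> : qk = quat 0 0 0 1 by rewrite /quat !scale0r !add0r scale1r.
  by rewrite /w0 !quatM quatN; apply: eq_quat; ring.
rewrite /circular_translation linear_factorM wE -/qk subrK mulrBl qkqk opprK.
rewrite reparametrize_quadratic // /circular_form; congr quadratic.
  rewrite scalerDr scalerA addrC -scalerAr scaleNr scalerN; congr (_ + _).
  by rewrite -scaleNr; congr (_ *: _); ring.
rewrite -!scalerAl -!scalerAr qkqk kw !mulrN !scalerN !scalerA.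
have e1 : - lam^-1 * - lam^-1 = lam ^- 2 by field.
have e2 : - (mu / lam) * - lam^-1 = lam ^- 2 * mu by field.
have e3 : (- (mu / lam)) ^+ 2 = lam ^- 2 * mu ^+ 2 by field.
rewrite e1 e2 e3 !opprK -(mulrA eps) !scalerDr scalerN !scalerA.
by rewrite [LHS](AC (2*2) (4*2*3*1)).
Qed.

Lemma conj_is_quat A m x : is_quat A -> is_quat x -> is_quat (A * x * (m^-1 *: reversion A)).
Proof. by move=> HA Hx; apply/is_quatM/is_quatZ/is_quat_reversion => //; apply: is_quatM. Qed.

(** Since [eps] squares to zero, [a] can be replaced by its quaternion part [A] next to [eps]. *)
Lemma conj_eps (a A B z x : CGA R) : is_quat A -> is_quat z -> is_quat x -> a = A + eps * B -> is_quat B ->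
  A * z = 1 -> z * A = 1 -> a \is a GRing.unit ->
  a * (eps * x) * a^-1 = eps * (A * x * z).
Proof.
move=> HA Hz Hx aE HB Az zA ua.
have ea : eps * a = eps * A by rewrite aE mulrDr mulrA eps2 mul0r addr0.
have ae : a * eps = A * eps.
  by rewrite aE mulrDl (eps_is_quat HB) -mulrA eps2 mulr0 addr0.
have ez : eps * a^-1 = z * eps.
  have := congr1 (fun u => u * a^-1) ea; rewrite /= mulrK // (eps_is_quat HA) -mulrA => e.
  by rewrite [in RHS]e mulrA zA mul1r.
rewrite mulrA ae -(mulrA A) -mulrA (eps_is_quat Hx) -(mulrA x) ez.
by rewrite (eps_is_quat (is_quatM (is_quatM HA Hx) Hz)) !mulrA.
Qed.

Lemma conj_circular_pair (A z p q : CGA R) m : is_quat A -> m != 0 -> A * reversion A = m%:A ->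
  reversion A * A = m%:A -> z = m^-1 *: reversion A -> circular_pair p q ->
  circular_pair (A * p * z) (A * q * z).
Proof.
move=> HA m0 AA AA' zE [Hp Hq rp rq pq].
have zA : z * A = 1 by rewrite zE -scalerAl AA' scalerA mulVf // scale1r.
have r x : reversion (A * x * z) = A * reversion x * z.
  by rewrite reversionM zE linearZ /= reversionK reversionM -scalerAl -scalerAr mulrA.
have M x y : A * x * z * (A * y * z) = A * (x * y) * z.
  by rewrite !mulrA -(mulrA _ z A) zA mulr1.
split; rewrite ?zE; try exact: conj_is_quat; rewrite -?zE.
- by rewrite r rp mulrN mulNr.
- by rewrite r rq mulrN mulNr.
by rewrite !M pq mulrN mulNr.
Qed.

(** Each coefficient of the form is a real number plus [eps] times a quaternion. Conjugation fixes
    the former and acts on the latter through [A] alone, so translations leave the form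
    unchanged. *)
Lemma conj_circular_form s (a p q A B : CGA R) c : c != 0 -> a = A + eps * B ->
  is_quat A -> is_quat B -> a * reversion a = c%:A -> reversion a * a = c%:A ->
  circular_pair p q ->
  exists z, [/\ A * z = 1, z * A = 1, circular_pair (A * p * z) (A * q * z) &
    a%:P * circular_form s p q * (a^-1)%:P = circular_form s (A * p * z) (A * q * z)].
Proof.
move=> c0 aE HA HB aa aa' pq.
have [m [AA AA' _ mA]] := is_quat_norm HA.
(* If [A] vanished, [a * reversion a] would be killed by [eps], but it is a nonzero real. *)
have A0 : A != 0.
  apply: contra c0 => /eqP A0; apply/eqP/(eps_scalar_eq0).
  by rewrite -aa aE A0 add0r (mulrA eps (eps * B)) (mulrA eps eps) eps2 !mul0r.
have m0 : m != 0 by apply: contra A0 => /eqP/mA/eqP.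
pose z := m^-1 *: reversion A.
have zA : z * A = 1 by rewrite -scalerAl AA' scalerA mulVf // scale1r.
have Az : A * z = 1 by rewrite -scalerAr AA scalerA mulVf // scale1r.
have Hz : is_quat z by apply/is_quatZ/is_quat_reversion.
have ua : a \is a GRing.unit.
  apply/unitrP; exists (c^-1 *: reversion a).
  by rewrite -scalerAl -scalerAr aa aa' scalerA mulVf // scale1r.
have Pz : circular_pair (A * p * z) (A * q * z) by apply: (conj_circular_pair HA m0).
clearbody z; exists z; split=> //.
have [Hp Hq rp rq pqC] := pq.
have [n [pp _ _]] := imaginary_sqr Hp rp.
have M x y : A * x * z * (A * y * z) = A * (x * y) * z.
  by rewrite !mulrA -(mulrA _ z A) zA mulr1.
have ce x : is_quat x -> a * (eps * x) * a^-1 = eps * (A * x * z).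
  by move=> Hx; apply: (conj_eps HA Hz Hx aE HB Az zA ua).
have cs r : a * r%:A * a^-1 = r%:A by rewrite -scalerAr mulr1 -scalerAl mulrV.
rewrite conj_quadratic ?mulrV // /circular_form !M; congr quadratic.
  by rewrite mulrBr mulrBl ce // cs.
rewrite pp mulrN mulNr -!scalerAr mulr1 -!scalerAl Az opprK.
rewrite mulrDr mulrDl cs !mulrBr !mulrBl cs -scalerAr -scalerAl !ce //.
exact: is_quatM.
Qed.

(** The witness is [u + v]: both products equal [m%:A + v * u]. It is zero only when [u = - v],
    where an element anticommuting with [u] serves instead. *)
Lemma rotation_exists (u v : CGA R) m : is_quat u -> is_quat v -> u * u = m%:A -> v * v = m%:A ->
  (u = - v -> exists A, [/\ is_quat A, A != 0 & A * u = - (u * A)]) ->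
  exists A, [/\ is_quat A, A != 0 & A * u = v * A].
Proof.
move=> Hu Hv uu vv; have [uv|uv _] := eqVneq (u + v) 0.
  have {}uv : u = - v by apply/eqP; rewrite -addr_eq0 uv.
  move=> /(_ uv) [A [HA A0 e]]; exists A; split=> //.
  by rewrite e uv mulNr opprK.
exists (u + v); split=> //; first exact: is_quatD.
by rewrite mulrDl mulrDr uu vv addrC.
Qed.

(** This is why only [e1] and [e2] occur in the translation: [eps * qi] and [eps * qj] are, up to
    sign, [e1 * ninf] and [e2 * ninf]. *)
Lemma anticomm_qk x : is_quat x -> qk * x = - (x * qk) -> exists b c, x = quat 0 b c 0.
Proof.
move=> [a [b [c [d ->]]]] e; exists b, c.
have : eps * (qk * quat a b c d + quat a b c d * qk) = 0 by rewrite e addNr mulr0.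
have -> : qk = quat 0 0 0 1 by rewrite /quat !scale0r !add0r scale1r.
rewrite !quatM !quatD => /eps_quat_eq0 [e1 _ _ e2].
have -> : a = 0 by lra.
by have -> : d = 0 by lra.
Qed.

Lemma circular_form_equivalent (x y lam mu : R) C : (x, y) <> (0, 0) -> lam != 0 ->
  euclidean_equivalent (reparametrize lam mu (circular_translation x y)) C ->
  exists s p q, [/\ circular_pair p q, p != 0, q != 0 & C = circular_form s p q].
Proof.
move=> xy l0 [a [/DHP [A [B [HA HB aE]]] [c [c0 aa aa']] ->]].
rewrite reparametrize_circular_translation //.
set p := - lam^-1 *: qk; set q := - lam^-1 *: quat 0 (- x) y 0.
have kE : qk = quat 0 0 0 1 by rewrite /quat !scale0r !add0r scale1r.
have li : - lam^-1 != 0 by rewrite oppr_eq0 invr_eq0.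
have pq : circular_pair p q.
  rewrite /p /q kE; split; try exact/is_quatZ/is_quat_mk.
  - by rewrite linearZ /= reversion_quat -scalerN quatN !oppr0.
  - by rewrite linearZ /= reversion_quat -scalerN quatN !oppr0.
  rewrite -!scalerAl -!scalerAr -!scalerN !quatM quatN.
  by congr (_ *: (_ *: _)); apply: eq_quat; ring.
have p0 : p != 0.
  rewrite scaler_eq0 (negPf li) /=; apply/eqP => k0; have := qkqk.
  by rewrite k0 mulr0 => /eqP; rewrite eq_sym oppr_eq0 oner_eq0.
have q0 : q != 0.
  rewrite scaler_eq0 (negPf li) /=; apply/eqP => w0; apply: xy.
  have : eps * quat 0 (- x) y 0 = 0 by rewrite w0 mulr0.
  by move=> /eps_quat_eq0 [_ /eqP + -> _]; rewrite oppr_eq0 => /eqP ->.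
have [z [Az zA pq' ->]] := conj_circular_form (- (mu / lam)) c0 aE HA HB aa aa' pq.
have nz u : u != 0 -> A * u * z != 0.
  have uE : z * (A * u * z) * A = u by rewrite !mulrA zA mul1r -mulrA zA mulr1.
  by apply: contra => /eqP e; rewrite -uE e mulr0 mul0r.
by exists (- (mu / lam)), (A * p * z), (A * q * z); split=> //; apply: nz.
Qed.

Lemma equivalent_circular_form s p q : circular_pair p q -> p != 0 -> q != 0 ->
  exists x y lam mu : R, [/\ (x, y) <> (0, 0), lam != 0 &
    euclidean_equivalent (reparametrize lam mu (circular_translation x y))
      (circular_form s p q)].
Proof.
move=> pq p0 q0; have [Hp Hq rp rq pqC] := pq.
have [n [pp n0 pn]] := imaginary_sqr Hp rp.
have {pn}n0 : 0 < n by rewrite lt_def n0 andbT; apply: contra p0 => /eqP/pn/eqP.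
have kE : qk = quat 0 0 0 1 by rewrite /quat !scale0r !add0r scale1r.
have Hk : is_quat qk by rewrite kE; apply: is_quat_mk.
pose r := Num.sqrt n; have r0 : r != 0 by rewrite sqrtr_eq0 -ltNge.
have rr : r * r = n by rewrite -expr2 sqr_sqrtr // ltW.
have [A [HA A0 Ak]] : exists A, [/\ is_quat A, A != 0 & A * (r *: qk) = p * A].
  apply: (@rotation_exists _ _ (- n)) => //.
  - exact: is_quatZ.
  - by rewrite -scalerAl -scalerAr qkqk scalerA rr scalerN scaleNr.
  - by rewrite pp scaleNr.
  (* In the antipodal case [qi] works, as it anticommutes with [qk]. *)
  move=> _; exists qi; split.
  - by have -> : qi = quat 0 1 0 0 by [rewrite /quat !scale0r add0r !addr0 scale1r]; apply: is_quat_mk.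
  - apply/eqP => k0; have := qiqi.
    by rewrite k0 mulr0 => /eqP; rewrite eq_sym oppr_eq0 oner_eq0.
  by rewrite -scalerAr qiqk -scalerAl qkqi scalerN.
have [m [AA AA' _ mA]] := is_quat_norm HA.
have m0 : m != 0 by apply: contra A0 => /eqP/mA/eqP.
pose A' := reversion A.
have HA' : is_quat A' by apply: is_quat_reversion.
(* Undoing the rotation [A] takes [p] to [r *: qk] and [q] to some [q'] anticommuting with [qk]. *)
have [Hp' Hq' _ _ pq'] : circular_pair (A' * p * (m^-1 *: A)) (A' * q * (m^-1 *: A)).
  by apply: (conj_circular_pair HA' m0); rewrite ?reversionK.
set q' := A' * q * _ in Hq' pq'.
have pE : A' * p * (m^-1 *: A) = r *: qk.
  by rewrite -mulrA -scalerAr -Ak -scalerAr mulrA AA' -scalerAl mul1r scalerA mulVf // scale1r.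
have [b [c q'E]] : exists b c, q' = quat 0 b c 0.
  apply: anticomm_qk => //; move: pq'; rewrite pE -scalerAl -scalerAr -scalerN.
  by move=> /(congr1 (fun x => r^-1 *: x)); rewrite !scalerA mulVf // !scale1r.
have qE : A * q' = q * A.
  by rewrite /q' -(mulrA A') mulrA AA -scalerAl mul1r -!scalerAr scalerA mulfV // scale1r.
pose lam := - r^-1.
have l0 : lam != 0 by rewrite oppr_eq0 invr_eq0.
have lr : - lam^-1 = r by rewrite /lam invrN opprK invrK.
(* The values solve [- lam^-1 = r], [- (mu / lam) = s] and [r *: quat 0 (- x) y 0 = q']. *)
exists (- (b / r)), (c / r), lam, (- (s * lam)); split=> //.
  move=> [/eqP + /eqP]; rewrite oppr_eq0 !mulf_eq0 invr_eq0 (negPf r0) !orbF => /eqP b0 /eqP c0.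
  have q'0 : q' = 0 by rewrite q'E b0 c0 quat_A scale0r.
  have := qE; rewrite q'0 mulr0 => /(congr1 (fun x => x * A')).
  rewrite /= mul0r -mulrA AA -scalerAr mulr1 => /esym/eqP.
  by rewrite scaler_eq0 (negPf m0) (negPf q0).
rewrite reparametrize_circular_translation // lr opprK.
have -> : r *: quat 0 (b / r) (c / r) 0 = q'.
  by rewrite quatZ q'E; apply: eq_quat; field.
have -> : - (- (s * lam) / lam) = s by field.
exists A; split; first exact: DH_is_quat.
  by exists m.
have pq0 : circular_pair (r *: qk) q'.
  by rewrite -pE; apply: (conj_circular_pair HA' m0); rewrite ?reversionK.
have AE : A = A + eps * 0 by rewrite mulr0 addr0.
have [z [Az zA _ ->]] := conj_circular_form s m0 AE HA (is_quat0) AA AA' pq0.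
by rewrite Ak qE -!mulrA Az !mulr1.
Qed.

End DualQuaternions.

Theorem theorem4p2 (R : realType) (C : {poly CGA R}) :
  (quadratic_euclidean_motion C /\ ~ trivial_motion C /\
   has_irregular_factorization C)
  <->
  (exists x y lam mu : R,
     (x, y) <> (0, 0) /\ lam <> 0 /\
     euclidean_equivalent (reparametrize lam mu (circular_translation x y)) C).
Proof.
split=> [[qC [_ iC]]|[x [y [lam [mu [xy [/eqP l0 eC]]]]]]].
  have [s [p [q [pq p0 q0 ->]]]] := circular_form_of_irregular qC iC.
  have [x [y [lam [mu [xy /eqP l0 e]]]]] := equivalent_circular_form s pq p0 q0.
  by exists x, y, lam, mu.
have [s [p [q [pq p0 q0 ->]]]] := circular_form_equivalent xy l0 eC.
exact: circular_form_lhs.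
Qed.
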